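(* Let $L\subset \#^r(S^1\times S^2)$ be a link such that $[L]\in H_1(\#^r(S^1\times S^2);\mathbb{Z})$ is $2$-divisible, represented by a diagram $D$. Let $O(L)$ denote the set of orientations of $L$ for which $L$ would be null-homologous in $\#^r(S^1\times S^2)$. Then the Lee homology of $L$ (over $\mathbb{Q}$) is $$\mathrm{Kh}_{\mathrm{Lee}}(L)\cong \mathbb{Q}^{|O(L)|},$$ generated by cycles $\mathfrak{s}_o$, $o\in O(L)$, corresponding to the oriented resolutions, according to the orientations $o\in O(L)$, of certain finite approximations $D(\vec k)$ (with $\vec k=(k,\dots,k)$, $k$ suitably large).
   Context: Diagrams. View $M=\#^r(S^1\times S^2)$ as the result of $0$-surgery on an $r$-component unlink in $S^3$. A diagram $D$ for a link $L\subset M$ is a link diagram in the plane together with $r$ disjoint arcs $\gamma_1,\dots,\gamma_r$ (projections of vertical disks whose boundaries are the unlink components), where $D$ meets each $\gamma_i$ transversely, away from crossings, in $n_i$ points; the disk over $\gamma_i$ is capped off by the surgery to the $i$-th sphere $\{*\}\times S^2$. When $[L]$ is $2$-divisible every $n_i$ is even. Let $\eta_i$ be the algebraic intersection number of $L$ with the $i$-th sphere. For $\vec k\in\mathbb{Z}^r$, the finite approximation $D(\vec k)$ is the link diagram in $S^3$ obtained by inserting $k_i$ right-handed full twists on the $n_i$ strands crossing $\gamma_i$. Orientations of $L$ correspond to orientations of the link $D(\vec k)$. Lee complex in $S^3$. For an oriented link diagram $E$ in the plane, the Lee complex is the Khovanov cube-of-resolutions complex over $\mathbb{Q}$ built from the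 Frobenius algebra $\mathbb{Q}[x]/(x^2-1)$ with $\mathrm q(1)=1$, $\mathrm q(x)=-1$, $\Delta(1)=1\otimes x+x\otimes 1$, $\Delta(x)=x\otimes x+1\otimes 1$, $\varepsilon(1)=0$, $\varepsilon(x)=1$; a vertex with $\rho$ one-resolutions lies in homological degree $\rho-n_-$ and carries $\mathrm q$-shift $\rho+n_+-2n_-$. For any orientation $o$ of the underlying link, the Lee generator $\mathfrak{s}_o$ is the cycle supported on the oriented resolution of $E$ with respect to $o$, with each circle $C$ labelled by $(-1)^{z(C)}1+x$, where $z(C)$ is the number of circles enclosing $C$, plus one if $C$ is oriented counter-clockwise. Lee homology in $M$. Let $\mathrm h^a\mathrm q^b$ denote upward shifts in homological and $\mathrm q$-degree. For $\vec k=(k,\dots,k)$, shift the Lee complex of $D(\vec k)$ by $\mathrm h^{-\sum_i\frac k2\eta_i^2}\,\mathrm q^{-\sum_i\frac{3k}2\eta_i^2}$. In each fixed homological degree the homology of the shifted complex stabilizes for $k$ sufficiently large, and $\mathrm{Kh}_{\mathrm{Lee}}(L)$ is the stable limit (independent of the diagram $D$ up to isomorphism). *)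

(* Defs.v *)
From HB Require Import structures.
From mathcomp Require Import all_boot all_order all_algebra.

Set Implicit Arguments.
Unset Strict Implicit.
Unset Printing Implicit Defensive.

Import Order.TTheory GRing.Theory Num.Theory.
Local Open Scope ring_scope.

(* A diagram is put in general position with respect to the height function
   of the plane and read from bottom to top as a list of slices.  The strands
   at each level are numbered from left to right, starting from 0.

     Cup p      a local minimum, whose legs become the strands p and p+1;
     Cap p      a local maximum, joining the strands p and p+1;
     Cross p b  a crossing of the strands p and p+1; the strand going from the
                bottom left to the top right is the upper one iff b = true
                (so b = true is the positive crossing if both strands go up);
     Arc i p n  the arc gamma_i, a horizontal segment meeting exactly the n
                strands p, ..., p+n-1.

   For r = 0 there are no arcs and one gets ordinary plane link diagrams. *)
Inductive slice (r : nat) : Type :=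
| Cup of nat
| Cap of nat
| Cross of nat & bool
| Arc of 'I_r & nat & nat.

Section Words.
Variable r : nat.
Implicit Types (s : slice r) (D : seq (slice r)) (o : seq bool).

Definition next_width (w : nat) s : nat :=
  match s with
  | Cup _ => w.+2
  | Cap _ => (w - 2)%N
  | Cross _ _ | Arc _ _ _ => w
  end.

Definition fits (w : nat) s : bool :=
  match s with
  | Cup p => (p <= w)%N
  | Cap p | Cross p _ => (p.+1 < w)%N
  | Arc _ p n => (p + n <= w)%N
  end.

(* The numbers of strands at the size D + 1 levels of D. *)
Definition widths D : seq nat := 0%N :: scanl next_width 0%N D.

Fixpoint fits_from (w : nat) D : bool :=
  if D is s :: D' then fits w s && fits_from (next_width w s) D' else w == 0%N.

Definition is_arc (i : 'I_r) s : bool := if s is Arc j _ _ then j == i else false.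

Definition is_diagram D : bool :=
  fits_from 0 D && [forall i : 'I_r, count (is_arc i) D == 1%N].

Definition is_cup s : bool := if s is Cup _ then true else false.

(* An orientation is recorded by one boolean for each local minimum, in the
   order of the slices: true iff the left leg points upwards.  Every component
   has a local minimum, so these booleans determine the orientation.
   [dirs_from D st o] lists the directions (true = up) of the strands at all
   levels of D, if st are the directions at the bottom. *)
Fixpoint dirs_from D (st : seq bool) o : seq (seq bool) :=
  st :: match D with
        | [::] => [::]
        | Cup p :: D' =>
            dirs_from D' (take p st ++ [:: head true o; ~~ head true o]
                            ++ drop p st) (behead o)
        | Cap p :: D' => dirs_from D' (take p st ++ drop p.+2 st) o
        | Cross p _ :: D' =>
            dirs_from D' (take p st ++ [:: nth true st p.+1; nth true st p]
                            ++ drop p.+2 st) o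
        | Arc _ _ _ :: D' => dirs_from D' st o
        end.

Definition dir D o (l p : nat) : bool :=
  nth true (nth [::] (dirs_from D [::] o) l) p.

(* The two strands ending in a local maximum must have opposite directions. *)
Definition coherent D o : bool :=
  [forall l : 'I_(size D),
     if tnth (in_tuple D) l is Cap p then dir D o l p != dir D o l p.+1
     else true].

(* The algebraic intersection number eta_i with the i-th sphere. *)
Definition eta D o (i : 'I_r) : int :=
  \sum_(l < size D)
    (if tnth (in_tuple D) l is Arc j p n then
       if j == i then \sum_(p <= q < p + n) (if dir D o l q then 1 else -1)
       else 0
     else 0).

End Words.

Record diagram (r : nat) := Diagram {
  slices :> seq (slice r);
  _ : is_diagram slices }.

Record orientation (r : nat) (D : diagram r) := Orientation {
  orientation_bits :> (count (@is_cup r) D).-tuple bool;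
  _ : coherent D orientation_bits }.

HB.instance Definition _ r (D : diagram r) :=
  [isSub for @orientation_bits r D].
HB.instance Definition _ r (D : diagram r) :=
  [Finite of orientation D by <:].

(* The class [L], through the isomorphism H_1(#^r(S^1 x S^2); Z) = Z^r given by
   the intersection numbers with the r spheres. *)
Definition homology_class r (D : diagram r) (o : orientation D) : 'rV[int]_r :=
  \row_i eta D o i.

Definition two_divisible r (c : 'rV[int]_r) : Prop :=
  exists c' : 'rV[int]_r, c = c' *+ 2.

Definition null_orientations r (D : diagram r) : {set orientation D} :=
  [set o | homology_class o == 0].

(* |k| full twists on the strands p, ..., p+n-1, right-handed iff k >= 0. *)
Definition full_twists (k : int) (p n : nat) : seq (slice 0) :=
  flatten (nseq (`|k|%N * n)
                [seq Cross 0 (p + j) (0 <= k) | j <- iota 0 n.-1]).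

(* The finite approximation D(k).  Its local minima are those of D, in the same
   order, and a full twist permutes no endpoints: the same booleans describe
   corresponding orientations of D and D(k). *)
Definition approx r (D : seq (slice r)) (k : 'I_r -> int) : seq (slice 0) :=
  flatten [seq match s with
               | Cup p => [:: Cup 0 p]
               | Cap p => [:: Cap 0 p]
               | Cross p b => [:: Cross 0 p b]
               | Arc i p n => full_twists (k i) p n
               end | s <- D].

Section LeeComplex.
Variable E : seq (slice 0).

Definition slice_at (l : 'I_(size E)) : slice 0 := tnth (in_tuple E) l.

Definition is_crossing (l : 'I_(size E)) : bool :=
  if slice_at l is Cross _ _ then true else false.

(* Vertices of the cube are given by the set of 1-resolved crossings. *)
Definition vertex := {set 'I_(size E)}.

(* Points of the diagram: (level, strand). *)
Definition point : finType := ('I_(size E).+1 * 'I_(size E).*2)%type.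

Definition points : {set point} :=
  [set x : point | (x.2 < nth 0%N (widths E) x.1)%N].

(* A slice without crossing is given by the position of its maximum, if any,
   and of its minimum, if any.  The resolutions of a crossing are two vertical
   strands, or a maximum below a minimum. *)
Definition flat_slice (s : slice 0) (b : bool) : option nat * option nat :=
  match s with
  | Cup p => (None, Some p)
  | Cap p => (Some p, None)
  | Cross p c => if c != b then (None, None) else (Some p, Some p)
  | Arc _ _ _ => (None, None)
  end.

(* The m-th strand different from the strands p and p+1, if a = Some p. *)
Definition skip (a : option nat) (m : nat) : nat :=
  if a is Some p then if (m < p)%N then m else m.+2 else m.

Definition turns (a : option nat) (q q' : nat) : bool :=
  if a is Some p then (q == p) && (q' == p.+1) else false.

Definition through (f : option nat * option nat) (q q' : nat) : bool :=
  [exists m : 'I_q.+1, (q == skip f.1 m) && (q' == skip f.2 m)].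

Definition adjacent (v : vertex) (x y : point) : bool :=
  [exists l : 'I_(size E), let f := flat_slice (slice_at l) (l \in v) in
    [|| [&& x.1 == l :> nat, y.1 == l.+1 :> nat & through f x.2 y.2],
        [&& x.1 == l :> nat, y.1 == l :> nat & turns f.1 x.2 y.2]
      | [&& x.1 == l.+1 :> nat, y.1 == l.+1 :> nat & turns f.2 x.2 y.2]]].

Definition circle_of (v : vertex) (x : point) : {set point} :=
  [set y | connect (fun a b => adjacent v a b || adjacent v b a) x y].

Definition circles (v : vertex) : {set {set point}} :=
  [set circle_of v x | x in points].

(* Generators: a vertex and a labelling of the circles of its resolution by
   1 and x, given by the set of circles labelled x. *)
Definition is_gen (g : vertex * {set {set point}}) : bool :=
  (g.1 \subset [set l | is_crossing l]) && (g.2 \subset circles g.1).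

Definition gen := {g : vertex * {set {set point}} | is_gen g}.
Definition gvertex (g : gen) : vertex := (val g).1.
Definition gxset (g : gen) : {set {set point}} := (val g).2.

Definition chain := {ffun gen -> rat^o}.
Definition basis_chain (g : gen) : chain := [ffun h => (h == g)%:R].

(* Structure constants of Q[x]/(x^2-1) in the basis 1, x.  The first argument
   is the number of factors x of the source, the second that of the target:
     1.1 = 1, 1.x = x.1 = x, x.x = 1;
     Delta(1) = 1(x)x + x(x)1, Delta(x) = x(x)x + 1(x)1. *)
Definition mult_coef (a b : nat) : rat :=
  match a, b with
  | 0%N, 0%N | 1%N, 1%N | 2%N, 0%N => 1
  | _, _ => 0
  end.
Definition comult_coef (a b : nat) : rat :=
  match a, b with
  | 0%N, 1%N | 1%N, 2%N | 1%N, 0%N => 1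
  | _, _ => 0
  end.

(* Coefficient of h in the differential of g; the circles of the two
   resolutions are compared as sets of points. *)
Definition lee_coef (g h : gen) : rat :=
  let v := gvertex g in let w := gvertex h in
  let A := circles v :\: circles w in
  let B := circles w :\: circles v in
  if [&& v \subset w, #|w :\: v| == 1%N & gxset g :\: A == gxset h :\: B] then
    (-1) ^+ #|[set l in v | [exists m in w :\: v, (l < m)%N]]|
    * (if (#|A| == 2%N) && (#|B| == 1%N) then
         mult_coef #|gxset g :&: A| #|gxset h :&: B|
       else if (#|A| == 1%N) && (#|B| == 2%N) then
         comult_coef #|gxset g :&: A| #|gxset h :&: B|
       else 0)
  else 0.

Definition lee_diff : 'End(chain) :=
  linfun (fun c : chain => [ffun h => \sum_g c g * lee_coef g h] : chain).

Section Oriented.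
Variable o : seq bool.

Definition is_negative (l : 'I_(size E)) : bool :=
  if slice_at l is Cross p b then b != (dir E o l p == dir E o l p.+1)
  else false.

Definition n_minus : nat := #|[set l | is_negative l]|.

Definition hdeg (g : gen) : int := #|gvertex g|%:Z - n_minus%:Z.

Definition graded_piece (j : int) : {vspace chain} :=
  <<[seq basis_chain g | g : gen in [pred g | hdeg g == j]]>>%VS.

Definition cycles (j : int) : {vspace chain} :=
  (graded_piece j :&: lker lee_diff)%VS.
Definition boundaries (j : int) : {vspace chain} :=
  (lee_diff @: graded_piece (j - 1))%VS.

(* The quotient of the cycles by the boundaries, realized as a complement of
   the boundaries in the cycles; the class of a cycle is its projection along
   the boundaries (see cycle_class_eq0 and cycle_class_surj). *)
Definition homology (j : int) : vectType rat :=
  subvs_of (cycles j :\: boundaries j)%VS.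
Definition cycle_class (j : int) (c : chain) : homology j :=
  vsproj (cycles j :\: boundaries j)%VS (addv_pi1 (cycles j) (boundaries j) c).

(* The oriented resolution: the 0-resolution of a positive crossing and the
   1-resolution of a negative one. *)
Definition oriented_resolution : vertex := [set l | is_negative l].

(* Number of points of C at the level of x lying to the left of x. *)
Definition left_of (C : {set point}) (x : point) : nat :=
  #|[set y in C | (y.1 == x.1) && (y.2 < x.2)%N]|.

Definition encloses (C' C : {set point}) : bool :=
  (C' != C) && [exists x in C, odd (left_of C' x)].

(* The interior of C is to the right of x in C iff left_of C x is even; C is
   counter-clockwise iff its interior is on the left hand side. *)
Definition counterclockwise (C : {set point}) : bool :=
  [exists x in C, dir E o x.1 x.2 == odd (left_of C x)].

Definition z_index (C : {set point}) : nat :=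
  (#|[set C' in circles oriented_resolution | encloses C' C]|
   + counterclockwise C)%N.

(* Expansion of the tensor product over the circles C of (-1)^z(C) 1 + x. *)
Definition lee_gen : chain :=
  [ffun g => if gvertex g == oriented_resolution then
               \prod_(C in circles oriented_resolution :\: gxset g)
                 (-1) ^+ z_index C
             else 0].

Lemma cycle_class_eq0 (j : int) (c : chain) :
  (boundaries j <= cycles j)%VS -> c \in cycles j ->
  (cycle_class j c == 0) = (c \in boundaries j).
Proof.
move=> sBZ Zc; set Z := cycles j in sBZ Zc *; set B := boundaries j in sBZ *.
have cE : addv_pi1 Z B c + addv_pi2 Z B c = c.
  by apply: addv_pi1_pi2; apply: subvP Zc; apply: addvSl.
have piD : addv_pi1 Z B c \in (Z :\: B)%VS by apply: memv_pi.
apply/eqP/idP => [h0 | Bc].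
  have /(congr1 vsval) := h0; rewrite vsprojK // linear0 => p0.
  by rewrite -cE p0 add0r; apply: memv_pi.
suff p0 : addv_pi1 Z B c = 0 by rewrite /cycle_class p0 linear0.
apply/eqP; rewrite -memv0 -(capv_diff Z B) memv_cap piD /=.
have -> : addv_pi1 Z B c = c - addv_pi2 Z B c by rewrite -{2}cE addrK.
by apply: rpredB => //; apply: memv_pi.
Qed.

Lemma cycle_class_surj (j : int) (u : homology j) :
  exists2 c, c \in cycles j & cycle_class j c = u.
Proof.
exists (vsval u); first exact: (subvP (diffvSl _ _)) (subvsP u).
rewrite /cycle_class /addv_pi1 daddv_pi_id ?vsvalK ?subvsP //.
exact: capv_diff.
Qed.

End Oriented.
End LeeComplex.

Section LeeHomology.
Variables (r : nat) (D : diagram r).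

(* The approximation D(k, ..., k). *)
Definition approx_diag (k : nat) : seq (slice 0) := approx D (fun=> k%:Z).

Variable oL : orientation D.

(* The complex of D(k, ..., k) is shifted upwards by - lee_shift k.  The
   divisions are exact when the class of L is 2-divisible. *)
Definition lee_shift (k : nat) : int :=
  \sum_(i < r) ((k%:Z * eta D oL i ^+ 2) %/ 2)%Z.

Definition approx_homology (k : nat) (h : int) : vectType rat :=
  homology (approx_diag k) oL (h + lee_shift k).

(* The stable limit: a graded vector space identified, in each degree h, with
   the homology of the shifted complex of D(k, ..., k) for all large k. *)
Record lee_limit := LeeLimit {
  lee_space :> int -> vectType rat;
  stable_from : int -> nat;
  lee_ident : forall (h : int) (k : nat),
    'Hom(approx_homology k h, lee_space h);
  lee_identP : forall (h : int) (k : nat), (stable_from h <= k)%N ->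
    lker (lee_ident h k) = 0%VS /\ limg (lee_ident h k) = fullv }.

Section Generators.
Variables (k : nat) (o : orientation D).

(* Degrees of the Lee generator of o before and after the shift. *)
Definition lee_gen_hdeg : int :=
  #|oriented_resolution (approx_diag k) o|%:Z - (n_minus (approx_diag k) oL)%:Z.
Definition lee_gen_degree : int := lee_gen_hdeg - lee_shift k.

Definition lee_gen_is_cycle : Prop :=
  lee_gen (approx_diag k) o \in cycles (approx_diag k) oL lee_gen_hdeg.

Definition lee_gen_class (V : lee_limit) (h : int) : V h :=
  lee_ident V h k
    (cycle_class oL (h + lee_shift k) (lee_gen (approx_diag k) o)).

End Generators.
End LeeHomology.

(* f is a linear isomorphism from Q^n onto the direct sum of the V h. *)
Definition direct_sum_iso (n : nat) (V : int -> vectType rat)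
    (f : 'rV[rat]_n -> forall h : int, V h) : Prop :=
  [/\ forall h, linear (fun a => f a h),
      forall a, exists s : seq int, forall h, h \notin s -> f a h = 0,
      forall a b, (forall h, f a h = f b h) -> a = b
    & forall v : (forall h : int, V h),
        (exists s : seq int, forall h, h \notin s -> v h = 0) ->
        exists a, forall h, f a h = v h].

(* Main.v *)
(* The algebra Q[x]/(x^2-1) is Q x Q through evaluation at x = 1 and x = -1, so
   the Lee complex of a diagram in the plane splits over the 2-colourings of its
   arcs: the generators of a summand are the resolutions all of whose circles are
   unicoloured, and every edge of the cube between two of them acts by a nonzero
   scalar.  A colouring with a crossing at which both resolutions are allowed
   gives an acyclic summand; the remaining ones have a single allowed resolution
   and correspond, by comparing the colour with the parity of the position of the
   strand, to the orientations of the link, the resolution being the oriented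
   one and the generator of the summand being the Lee generator.  Planarity
   enters because orienting the strands alternately upwards and downwards is
   compatible with all resolutions: the circles are the orbits of a permutation
   which changes by a transposition along an edge of the cube, so that an edge
   merges two circles or splits one.

   In D(k) the Lee generator of o lies, after the shift, in a degree of the form
   c(o) - k * sum_i eta_i(o)^2 / 2.  As k grows, the orientations that are not
   null-homologous leave every fixed degree, the others do not move. *)

From HB Require Import structures.
From mathcomp Require Import all_boot all_order all_algebra.
From mathcomp Require Import fingroup perm.
From mathcomp Require Import zify ring lra.
Require Import Defs.

Set Implicit Arguments.
Unset Strict Implicit.
Unset Printing Implicit Defensive.

Import Order.TTheory GRing.Theory Num.Theory.
Local Open Scope ring_scope.

(** The summands are never built as complexes. A labelling is a set [chi] of points of the diagram,
    independent of the vertex, so that values of a chain at different vertices can be compared; each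
    pair of a vertex and a compatible labelling gives a linear functional, and these are jointly
    injective by Fourier inversion over the sets of circles. The edge scalars, which are 1, 2 or -2,
    are gauged away by a potential on the vertices. What remains is a signed cube restricted to the
    vertices compatible with [chi], where both d d = 0 and the contraction of the acyclic summands
    can be read off. The Lee generators are dual, up to nonzero scalars, to the functionals at
    labellings without monochromatic crossing; this gives spanning and freeness modulo boundaries
    without counting dimensions. In the limit the threshold on k depends on the degree and on the
    chosen identifications; a uniform k exists because only finitely many degrees carry homology. *)

(** * Orbits of a permutation multiplied by a transposition *)

Section TranspositionOrbits.
Variables (T : finType) (s : {perm T}) (x y : T).
Hypothesis neq_xy : x != y.
Let s' := (tperm x y * s)%g.

(** The transposition changes the number of orbits by one, upwards or downwards according to whether
    x and y share an orbit; applying it twice restores the number, so the two situations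
    alternate. *)
Lemma porbit_tperm_mem : (x \in porbit s' y) = (x \notin porbit s y).
Proof.
have h1 := porbits_mul_tperm s x y; have h2 := porbits_mul_tperm s' x y.
rewrite /= /s' mulgA tperm2 mul1g in h1 h2.
by move: h1 h2; rewrite neq_xy; do 2!case: (x \in _) => /=; lia.
Qed.

Lemma porbit_tperm_id z :
  x \notin porbit s z -> y \notin porbit s z -> porbit s' z = porbit s z.
Proof.
move=> xz yz.
have E i : (s' ^+ i)%g z = (s ^+ i)%g z.
  elim: i => [|i IH]; first by rewrite !expg0.
  rewrite !expgSr !permM IH tpermD //.
    by apply: contraNneq xz => ->; rewrite mem_porbit.
  by apply: contraNneq yz => ->; rewrite mem_porbit.
apply/setP => u; apply/porbitP/porbitP => -[i ->]; exists i; by rewrite E.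
Qed.

(** [lee_coef] finds the circles involved in an edge as a difference of two sets of circles,
    computed here. If the orbit of x or y survived, x and y would share an orbit for [s] iff they do
    for [s'], against [porbit_tperm_mem]. *)
Lemma porbit_tpermD (P : {set T}) : x \in P -> y \in P ->
  [set porbit s z | z in P] :\: [set porbit s' z | z in P]
  = [set porbit s x; porbit s y].
Proof.
move=> Px Py; apply/setP => C; rewrite inE in_set2.
have orbE (t : {perm T}) u z : u \in porbit t z -> porbit t z = porbit t u.
  by rewrite -eq_porbit_mem => /eqP.
apply/andP/orP.
  case=> nC /imsetP [z Pz CE]; rewrite CE.
  case: (boolP (x \in porbit s z)) => [/orbE -> | xz]; first by left.
  case: (boolP (y \in porbit s z)) => [/orbE -> | yz]; first by right.
  by case/imsetP: nC; exists z => //; rewrite CE porbit_tperm_id.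
have aux z u : z \in P -> porbit s' z != porbit s u \/ u \notin [set x; y].
  move=> Pz; case: (boolP (u \in _)) => [uxy | _]; last by right.
  left; apply/eqP => zu.
  have us' : porbit s' u = porbit s u.
    by rewrite -zu; apply/esym/orbE; rewrite zu porbit_id.
  have := porbit_tperm_mem; move: uxy us'; rewrite in_set2.
  case/orP => /eqP -> us'; last by rewrite us'; case: (x \in _).
  by rewrite porbit_sym us' [in RHS]porbit_sym; case: (y \in _).
case=> /eqP ->; (split; last by [apply: imset_f]); apply/imsetP => -[z Pz E].
  by case: (aux z x Pz); rewrite ?E ?eqxx ?in_set2 ?eqxx.
by case: (aux z y Pz); rewrite ?E ?eqxx ?in_set2 ?eqxx ?orbT.
Qed.

End TranspositionOrbits.

(** * Resolutions as orbits of a permutation *)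

Definition slice0 : slice 0 := Cup 0 0.

Definition unskip (a : option nat) (q : nat) : nat :=
  if a is Some p then if (q < p)%N then q else (q - 2)%N else q.

(* The other end of the arc of a flat slice that starts on the side whose turn
   is [a]; the boolean tells whether this end lies on the other side. *)
Definition across (a a' : option nat) (q : nat) : bool * nat :=
  if a is Some p then
    if q == p then (false, p.+1) else if q == p.+1 then (false, p)
    else (true, skip a' (unskip a q))
  else (true, skip a' q).

(** The relations behind [adjacent] are graphs of functions, so that a resolution becomes a map on
    points. *)
Lemma through_across f q q' :
  through f q q' = (across f.1 f.2 q == (true, q')).
Proof.
case: f => a a' /=.
apply/existsP/eqP => [[m /andP [/= /eqP E /eqP E']] | ].
  move: E E'; rewrite /across /skip /unskip.
  case: a => [p|]; case: a' => [p'|]; repeat case: ifP => //; move=> *; try (congr pair); lia.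
move=> H.
have mq : (unskip a q < q.+1)%N by rewrite /unskip; case: a {H} => [p|]; try case: ifP; lia.
exists (Ordinal mq) => /=; move: H {mq}; rewrite /across /skip /unskip.
case: a => [p|]; case: a' => [p'|]; repeat case: ifP => //; move=> *;
 repeat match goal with H : (_, _) = (_, _) |- _ => case: H => * end; lia.
Qed.

Lemma through_acrossV f q q' :
  through f q q' = (across f.2 f.1 q' == (true, q)).
Proof.
rewrite -(through_across (f.2, f.1)); case: f => a a'.
apply/existsP/existsP => -[m /andP [/= /eqP E /eqP E']].
  have mq : (m < q'.+1)%N by move: E'; rewrite /skip; case: a' => [p|]; try case: ifP; lia.
  by exists (Ordinal mq); rewrite /= -E -E' !eqxx.
have mq : (m < q.+1)%N by move: E'; rewrite /skip; case: a => [p|]; try case: ifP; lia.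
by exists (Ordinal mq); rewrite /= -E -E' !eqxx.
Qed.

Lemma turns_across a a' q q' :
  turns a q q' || turns a q' q = (across a a' q == (false, q')).
Proof.
rewrite /turns /across; case: a => [p|]; last by [].
by repeat case: ifP; rewrite ?xpair_eqE //= => *; lia.
Qed.

(** Turns remove or insert two neighbouring strands at a time, so a strand passing through keeps its
    parity, while the two ends of a turn have opposite parities. This is why the alternating
    orientation suits every resolution. *)
Lemma across_parity a a' q :
  odd (across a a' q).2 = (across a a' q).1 (+) ~~ odd q.
Proof.
rewrite /across /skip /unskip; case: a => [p|]; case: a' => [p'|];
rewrite /=; repeat case: ifP => //=; lia.
Qed.

Lemma acrossK a a' q s q' : across a a' q = (s, q') ->
  (if s then across a' a q' else across a a' q') = (s, q).
Proof.
case: s => [/eqP|/eqP].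
  by rewrite -(through_across (a, a')) through_acrossV => /eqP.
by rewrite -turns_across orbC (turns_across a a') => /eqP.
Qed.

Lemma across_turn p a (r : bool) :
  across (Some p) a (p + r) = (false, p + ~~ r)%N.
Proof. by case: r; rewrite /= ?addn0 ?addn1 eqxx //; case: ifP => //; lia. Qed.

Lemma across_crossing p a q : q != p -> q != p.+1 ->
  a \in [:: None; Some p] -> across a a q = (true, q).
Proof.
move=> qp qp1; rewrite !inE => /orP [] /eqP -> //=.
rewrite (negbTE qp) (negbTE qp1) /unskip /skip; congr (_, _).
by case: (ltnP q p) => h; case: ifP => h'; lia.
Qed.

Section Geometry.
Variable E : seq (slice 0).
Hypothesis fitsE : fits_from 0 E.

Let n := size E.
Let point := point E.
Let vertex := vertex E.

Definition width l := nth 0%N (widths E) l.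

Lemma fits_from_nth w (D : seq (slice 0)) l : fits_from w D -> (l < size D)%N ->
  let W := nth 0%N (w :: scanl (@next_width 0) w D) in
  fits (W l) (nth slice0 D l) /\ W l.+1 = next_width (W l) (nth slice0 D l).
Proof.
elim: D w l => [|s D IH] w [|l] //= /andP [f1 f2] //=; rewrite ltnS => lD.
exact: (IH (next_width w s) l f2 lD).
Qed.

Lemma fits_from_last w (D : seq (slice 0)) : fits_from w D ->
  nth 0%N (w :: scanl (@next_width 0) w D) (size D) = 0%N.
Proof.
elim: D w => [|s D IH] w /=; first by move/eqP.
by case/andP=> _ /IH.
Qed.

Lemma width_last : width n = 0%N. Proof. exact: fits_from_last. Qed.

Lemma widthS l : (l < n)%N ->
  fits (width l) (nth slice0 E l) /\
  width l.+1 = next_width (width l) (nth slice0 E l).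
Proof. exact: fits_from_nth. Qed.

(** A slice adds at most two strands: this is the bound that makes the type [point] large enough. *)
Lemma width_le l : (l <= n)%N -> (width l <= l.*2)%N.
Proof.
elim: l => [|l IH] ln //; have [_ ->] := widthS ln.
have := IH (ltnW ln); case: (nth _ _ _) => [p|p|p b|i p m] /=; lia.
Qed.

Definition flat (b : bool) l := flat_slice (nth slice0 E l) b.

(** The witness [u] is the number of strands passing through the slice. *)
Lemma flat_width b l : (l < n)%N -> exists u,
  [/\ width l = (if (flat b l).1 is Some _ then u.+2 else u),
      width l.+1 = (if (flat b l).2 is Some _ then u.+2 else u),
      (if (flat b l).1 is Some p then (p <= u)%N else true) &
      (if (flat b l).2 is Some p then (p <= u)%N else true)].
Proof.
move=> ln; have [] := widthS ln; rewrite /flat.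
case: (nth _ _ _) => [p|p|p c|[[]]//] /=.
- by exists (width l).
- by exists (width l - 2)%N; split => //; lia.
- case: (c != b) => /=; first by exists (width l).
  by exists (width l - 2)%N; split => //; lia.
Qed.

Lemma across_up b l q s q' : (l < n)%N -> (q < width l)%N ->
  across (flat b l).1 (flat b l).2 q = (s, q') ->
  (q' < width (if s then l.+1 else l))%N.
Proof.
move=> ln; have [u []] := flat_width b ln; case: (flat b l) => [[p|] [p'|]] /=;
  move=> E1 E2 h1 h2 ql; rewrite /across /skip /unskip;
  repeat case: ifP => //=; move=> *;
  repeat match goal with H : (_, _) = (_, _) |- _ => case: H => *; subst end; lia.
Qed.

Lemma across_dn b l q s q' : (l < n)%N -> (q < width l.+1)%N ->
  across (flat b l).2 (flat b l).1 q = (s, q') ->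
  (q' < width (if s then l else l.+1))%N.
Proof.
move=> ln; have [u []] := flat_width b ln; case: (flat b l) => [[p|] [p'|]] /=;
  move=> E1 E2 h1 h2 ql; rewrite /across /skip /unskip;
  repeat case: ifP => //=; move=> *;
  repeat match goal with H : (_, _) = (_, _) |- _ => case: H => *; subst end; lia.
Qed.

(** Membership extended by [false] to all naturals, so that the slice below a level can be named by
    a predecessor. *)
Definition one_resolved (v : vertex) (l : nat) : bool :=
  oapp (fun m => m \in v) false (insub l).

Lemma one_resolved_ord (v : vertex) (l : 'I_n) : one_resolved v l = (l \in v).
Proof. by rewrite /one_resolved valK. Qed.

Definition flat_at v l := flat (one_resolved v l) l.

Lemma flat_atE (v : vertex) (l : 'I_n) :
  flat_slice (slice_at l) (l \in v) = flat_at v l.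
Proof.
by rewrite /flat_at one_resolved_ord /flat /slice_at (tnth_nth slice0).
Qed.

Notation P := (points E).

Lemma in_points (x : point) : (x \in P) = (x.2 < width x.1)%N.
Proof. by rewrite inE. Qed.

(** The extreme levels are empty, so every point has a slice above it and a slice below it. *)
Lemma points_level (x : point) : x \in P -> (0 < x.1 < n)%N.
Proof.
rewrite in_points => h; have := ltn_ord x.1; rewrite ltnS leq_eqVlt.
case/orP => [/eqP xn | ->]; first by rewrite xn width_last in h.
by rewrite andbT; case: (val x.1) h.
Qed.

(** [x] supplies a default strand number; [mkpointP] shows that it is not taken inside the
    diagram. *)
Definition mkpoint (x : point) (l q : nat) : point := (inord l, insubd x.2 q).

Lemma mkpointP x l q : (l <= n)%N -> (q < width l)%N ->
  [/\ mkpoint x l q \in P, (mkpoint x l q).1 = l :> nat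
    & (mkpoint x l q).2 = q :> nat].
Proof.
move=> ln ql.
have q2 : (q < n.*2)%N by have := width_le ln; lia.
have E1 : (mkpoint x l q).1 = l :> nat by rewrite /= inordK.
have E2 : (mkpoint x l q).2 = q :> nat by rewrite /= val_insubd q2.
by split=> //; rewrite in_points E1 E2.
Qed.

(** The other end of the arc that leaves x through the slice above; it lies on the level of x if
    that arc is a maximum. *)
Definition up (v : vertex) (x : point) : point :=
  let f := flat_at v x.1 in let a := across f.1 f.2 x.2 in
  mkpoint x (if a.1 then x.1.+1 else x.1) a.2.

Definition down (v : vertex) (x : point) : point :=
  let l := x.1.-1 in let f := flat_at v l in let a := across f.2 f.1 x.2 in
  mkpoint x (if a.1 then l else x.1) a.2.

Lemma upP v x : x \in P -> let f := flat_at v x.1 in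
  let a := across f.1 f.2 x.2 in
  [/\ up v x \in P, (up v x).1 = (if a.1 then x.1.+1 else x.1) :> nat
    & (up v x).2 = a.2 :> nat].
Proof.
move=> Px f a; have /andP [x0 xn] := points_level Px.
rewrite /up -/f -/a; apply: mkpointP; first by case: a.1; rewrite // ltnW.
have xw : (x.2 < width x.1)%N by rewrite -in_points.
exact: across_up xn xw (surjective_pairing _).
Qed.

Lemma downP v x : x \in P -> let f := flat_at v x.1.-1 in
  let a := across f.2 f.1 x.2 in
  [/\ down v x \in P, (down v x).1 = (if a.1 then x.1.-1 else x.1) :> nat
    & (down v x).2 = a.2 :> nat].
Proof.
move=> Px f a; have /andP [x0 xn] := points_level Px.
have x1 : x.1.-1.+1 = x.1 by rewrite prednK.
rewrite /down -/f -/a; apply: mkpointP; first by case: a.1; lia.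
have xn' : (x.1.-1 < n)%N by lia.
have xw : (x.2 < width x.1.-1.+1)%N by rewrite x1 -in_points.
by have := across_dn xn' xw (surjective_pairing _); rewrite x1; apply.
Qed.

Lemma point_eq (x y : point) :
  (x == y) = (x.1 == y.1 :> nat) && (x.2 == y.2 :> nat).
Proof. by case: x y => [a b] [c d]; rewrite xpair_eqE. Qed.

Lemma up_eq v v' (x : point) :
  let a u := across (flat_at u x.1).1 (flat_at u x.1).2 x.2 in
  a v = a v' -> up v x = up v' x.
Proof. by rewrite /up => /= ->. Qed.

Lemma down_eq v v' (x : point) :
  let a u := across (flat_at u x.1.-1).2 (flat_at u x.1.-1).1 x.2 in
  a v = a v' -> down v x = down v' x.
Proof. by rewrite /down => /= ->. Qed.

Opaque up down.

(** Equal parities mean that the arc passed through, and [down] leads back; otherwise it turned, and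
    [up] leads back. *)
Lemma up_parity v x y : x \in P -> y = up v x ->
  if odd y.2 == odd x.2 then down v y = x else up v y = x.
Proof.
move=> Px Ey; have := upP v Px; rewrite -Ey /=; set f := flat_at v x.1.
have := across_parity f.1 f.2 x.2; have := @acrossK f.1 f.2 x.2.
case: (across _ _ _) => s q /(_ _ _ erefl) /= qK par [Py y1 y2].
rewrite y2 par; case: s qK y1 {par} => qK y1 /=; rewrite ?negbK ?eqxx.
  apply/eqP; rewrite point_eq.
  have := downP v Py; rewrite y1 /= y2 -/f qK /= => -[_ -> ->].
  by rewrite !eqxx.
case: ifP => [|_]; first by case: (odd _).
apply/eqP; rewrite point_eq.
by have := upP v Py; rewrite y1 y2 /= -/f qK => -[_ -> ->]; rewrite !eqxx.
Qed.

Lemma down_parity v x y : x \in P -> y = down v x ->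
  if odd y.2 == odd x.2 then up v y = x else down v y = x.
Proof.
move=> Px Ey; have := downP v Px; rewrite -Ey /=; set f := flat_at v _.
have /andP [x0 xn] := points_level Px.
have := across_parity f.2 f.1 x.2; have := @acrossK f.2 f.1 x.2.
case: (across _ _ _) => s q /(_ _ _ erefl) /= qK par [Py y1 y2].
rewrite y2 par; case: s qK y1 {par} => qK y1 /=; rewrite ?negbK ?eqxx.
  apply/eqP; rewrite point_eq.
  have := upP v Py; rewrite y1 /= y2 -/f qK /= => -[_ -> ->].
  by rewrite prednK // !eqxx.
case: ifP => [|_]; first by case: (odd _).
apply/eqP; rewrite point_eq.
by have := downP v Py; rewrite y1 y2 /= -/f qK => -[_ -> ->]; rewrite !eqxx.
Qed.

Definition symadj (v : vertex) : rel point :=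
  fun a b => adjacent v a b || adjacent v b a.

Lemma symadjE v x y : x \in P -> symadj v x y = (y == up v x) || (y == down v x).
Proof.
move=> Px; have /andP [x0 xn] := points_level Px.
have x1n : (x.1.-1 < n)%N by lia.
have x1 : x.1.-1.+1 = x.1 by rewrite prednK.
rewrite !point_eq.
have := upP v Px; have := downP v Px; cbv zeta.
move=> [_ -> ->] [_ -> ->]; apply/orP/orP.
  case=> /existsP [l] /=; rewrite flat_atE;
    case/or3P=> /and3P [/eqP El /eqP El' h];
    rewrite ?El ?El' ?eqxx /=; move: h; set f := flat_at v l.
  - by rewrite through_across => /eqP ->; left; rewrite !eqxx.
  - move=> h; have : turns f.1 x.2 y.2 || turns f.1 y.2 x.2 by rewrite h.
    by rewrite (turns_across _ f.2) => /eqP ->; left; rewrite !eqxx.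
  - move=> h; have : turns f.2 x.2 y.2 || turns f.2 y.2 x.2 by rewrite h.
    by rewrite (turns_across _ f.1) => /eqP ->; right; rewrite !eqxx.
  - by rewrite through_acrossV => /eqP ->; right; rewrite !eqxx.
  - move=> h; have : turns f.1 x.2 y.2 || turns f.1 y.2 x.2 by rewrite h orbT.
    by rewrite (turns_across _ f.2) => /eqP ->; left; rewrite !eqxx.
  - move=> h; have : turns f.2 x.2 y.2 || turns f.2 y.2 x.2 by rewrite h orbT.
    by rewrite (turns_across _ f.1) => /eqP ->; right; rewrite !eqxx.
case; set f := flat_at v _ => /andP [/eqP yx1 /eqP yx2].
  case Ea : (across f.1 f.2 x.2) yx1 yx2 => [[] q] /= yx1 yx2.
    left; apply/existsP; exists (Ordinal xn) => /=; rewrite flat_atE /=.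
    by rewrite -/f through_across Ea yx1 yx2 !eqxx.
  move/eqP: Ea; rewrite -turns_across -yx2 => /orP [] h; [left|right];
    apply/existsP; exists (Ordinal xn) => /=; rewrite flat_atE /= -/f h yx1.
    by rewrite !eqxx /= orbT.
  by rewrite !eqxx /= orbT.
case Ea : (across f.2 f.1 x.2) yx1 yx2 => [[] q] /= yx1 yx2.
  right; apply/existsP; exists (Ordinal x1n) => /=; rewrite flat_atE /=.
  by rewrite -/f through_acrossV Ea yx1 yx2 x1 !eqxx.
move/eqP: Ea; rewrite -turns_across -yx2 => /orP [] h; [left|right];
  apply/existsP; exists (Ordinal x1n) => /=; rewrite flat_atE /= -/f h yx1 x1.
  by rewrite !eqxx /= !orbT.
by rewrite !eqxx /= !orbT.
Qed.

(** One step in the alternating orientation. It is the identity off the diagram, so as to give a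
    permutation of the whole type. *)
Definition next_point (v : vertex) (x : point) : point :=
  if x \in P then if odd x.2 then down v x else up v x else x.
Definition prev_point (v : vertex) (x : point) : point :=
  if x \in P then if odd x.2 then up v x else down v x else x.

Lemma up_in v x : x \in P -> up v x \in P. Proof. by case/(upP v). Qed.
Lemma down_in v x : x \in P -> down v x \in P. Proof. by case/(downP v). Qed.

Lemma next_pointK v : cancel (next_point v) (prev_point v).
Proof.
move=> x; rewrite /next_point /prev_point; case: (boolP (x \in P)) => [Px | /negbTE -> //].
have Pu := up_in v Px; have Pd := down_in v Px.
case ox: (odd x.2); [rewrite Pd | rewrite Pu].
  by have := down_parity Px (erefl (down v x)); rewrite ox; case: (odd _).
by have := up_parity Px (erefl (up v x)); rewrite ox; case: (odd _).
Qed.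

Definition orient_perm v : {perm point} := perm (can_inj (@next_pointK v)).

Lemma orient_perm_in v x : x \in P -> orient_perm v x \in P.
Proof.
by move=> Px; rewrite permE /next_point Px; case: ifP => _; [apply: down_in | apply: up_in].
Qed.

Lemma prev_pointK v : cancel (prev_point v) (next_point v).
Proof.
move=> x; rewrite /next_point /prev_point; case: (boolP (x \in P)) => [Px | /negbTE -> //].
have Pu := up_in v Px; have Pd := down_in v Px.
case ox: (odd x.2); [rewrite Pu | rewrite Pd].
  by have := up_parity Px (erefl (up v x)); rewrite ox; case: (odd _).
by have := down_parity Px (erefl (down v x)); rewrite ox; case: (odd _).
Qed.

Lemma symadj_perm v x y : x \in P ->
  symadj v x y = (y == orient_perm v x) || (x == orient_perm v y).
Proof.
move=> Px; have -> : (x == orient_perm v y) = (y == prev_point v x).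
  by rewrite permE -{1}(prev_pointK v x) (can_eq (@next_pointK v)) eq_sym.
rewrite symadjE // permE /next_point /prev_point Px.
by case: (odd x.2) => //; rewrite orbC.
Qed.

Lemma symadj_in v x y : symadj v x y -> (x \in P) = (y \in P).
Proof.
have aux u w : symadj v u w -> u \in P -> w \in P.
  move=> uw Pu; move: uw; rewrite symadjE //.
  by case/orP=> /eqP ->; [apply: up_in | apply: down_in].
move=> xy; apply/idP/idP; apply: aux => //.
by rewrite /symadj orbC.
Qed.

Lemma circle_porbit v x : x \in P -> circle_of v x = porbit (orient_perm v) x.
Proof.
move=> Px; apply/setP => y; rewrite inE; apply/idP/porbitP.
  (* An orbit is closed under successors and predecessors, hence under adjacency, so it contains the
     whole connected component. *)
  move=> xy; have /(closed_connect) : closed (symadj v) (mem (P :&: porbit (orient_perm v) x)).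
    have sub u w : symadj v u w -> u \in P :&: porbit (orient_perm v) x ->
        w \in P :&: porbit (orient_perm v) x.
      move=> uw; rewrite !in_setI -(symadj_in uw) => /andP [Pu xu].
      rewrite Pu /=; move: uw; rewrite symadj_perm // => /orP [] /eqP uw.
        by rewrite uw; case/porbitP: xu => i ->; rewrite -permM -expgSr mem_porbit.
      rewrite porbit_sym -(porbit_perm _ 1 w) expg1 -uw porbit_sym.
      exact: xu.
    move=> u w uw; apply/idP/idP; apply: sub => //.
    by rewrite /symadj orbC.
  move=> /(_ _ _ xy); rewrite !in_setI Px porbit_id /=.
  by move/esym/andP => [_ /porbitP].
case=> i ->; elim: i => [|i IH]; first by rewrite expg0 perm1 connect0.
apply: connect_trans IH (connect1 _).
have Pz : (orient_perm v ^+ i)%g x \in P.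
  elim: (i) => [|j IH']; first by rewrite expg0 perm1.
  by rewrite expgSr permM orient_perm_in.
by have := symadj_perm v ((orient_perm v ^+ i.+1)%g x) Pz; rewrite expgSr permM eqxx.
Qed.

Lemma circlesE v : circles v = [set porbit (orient_perm v) x | x in P].
Proof. by apply: eq_in_imset => x; apply: circle_porbit. Qed.

Definition crossings : vertex := [set l | is_crossing l].

Definition crossing_pos (m : 'I_n) : nat :=
  if slice_at m is Cross p _ then p else 0%N.

Definition crossing_sign (m : 'I_n) : bool :=
  if slice_at m is Cross _ c then c else false.

Lemma flat_crossing v m : m \in crossings -> flat_at v m =
  if crossing_sign m != (m \in v) then (None, None)
  else (Some (crossing_pos m), Some (crossing_pos m)).
Proof.
rewrite inE -flat_atE /is_crossing /crossing_sign /crossing_pos.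
by case: (slice_at m).
Qed.

Lemma crossing_width m : m \in crossings ->
  ((crossing_pos m).+1 < width m)%N /\ width m.+1 = width m.
Proof.
rewrite inE /is_crossing /crossing_pos /slice_at (tnth_nth slice0) /=.
by have := widthS (ltn_ord m); case: (nth _ _ _).
Qed.

Fact double_size_gt0 (m : 'I_n) : (0 < n.*2)%N.
Proof. by case: m => m; case: (n). Qed.

Definition crossing_point (m : 'I_n) (top right : bool) : point :=
  mkpoint (widen_ord (leqnSn n) m, Ordinal (double_size_gt0 m))
    (m + top) (crossing_pos m + right).

(* In the alternating orientation (even strands upwards, odd ones downwards)
   two opposite corners of a crossing are incoming, and changing the resolution
   exchanges their successors. *)
Definition cornerX (m : 'I_n) : point := crossing_point m (odd (crossing_pos m)) false.
Definition cornerY (m : 'I_n) : point := crossing_point m (~~ odd (crossing_pos m)) true.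

Lemma crossing_pointP m t r : m \in crossings ->
  [/\ crossing_point m t r \in P, (crossing_point m t r).1 = m + t :> nat
    & (crossing_point m t r).2 = crossing_pos m + r :> nat]%N.
Proof.
move=> /crossing_width [h1 h2]; apply: mkpointP.
  by case: t; rewrite ?addn1 ?addn0 // ltnW.
by case: t; rewrite ?addn1 ?addn0 ?h2; case: r; rewrite ?addn1 ?addn0 // ltnW.
Qed.

Lemma cornerX_in m : m \in crossings -> cornerX m \in P.
Proof. by case/(crossing_pointP (odd (crossing_pos m)) false). Qed.

Lemma cornerY_in m : m \in crossings -> cornerY m \in P.
Proof. by case/(crossing_pointP (~~ odd (crossing_pos m)) true). Qed.

Lemma corner_neq m : m \in crossings -> cornerX m != cornerY m.
Proof.
move=> Km; rewrite point_eq.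
have [_ _ ->] := crossing_pointP (odd (crossing_pos m)) false Km.
have [_ _ ->] := crossing_pointP (~~ odd (crossing_pos m)) true Km.
rewrite negb_and; apply/orP; right; lia.
Qed.

Opaque crossing_point.

Lemma up_crossing v m r : m \in crossings ->
  up v (crossing_point m false r) =
  if crossing_sign m != (m \in v) then crossing_point m true r
  else crossing_point m false (~~ r).
Proof.
move=> Km; have [Pz z1 z2] := crossing_pointP false r Km.
have := upP v Pz; rewrite {}z1 {}z2 addn0 flat_crossing //; cbv zeta.
have H t r' := crossing_pointP t r' Km.
case: (_ != _); rewrite ?across_turn /= => -[_ u1 u2]; apply/eqP; rewrite point_eq u1 u2.
  by case: (H true r) => _ -> ->; rewrite addn1 !eqxx.
by case: (H false (~~ r)) => _ -> ->; rewrite ?addn0 ?addn1 !eqxx.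
Qed.

Lemma down_crossing v m r : m \in crossings ->
  down v (crossing_point m true r) =
  if crossing_sign m != (m \in v) then crossing_point m false r
  else crossing_point m true (~~ r).
Proof.
move=> Km; have [Pz z1 z2] := crossing_pointP true r Km.
have := downP v Pz; rewrite {}z1 {}z2 addn1 /= flat_crossing //; cbv zeta.
have H t r' := crossing_pointP t r' Km.
case: (_ != _); rewrite ?across_turn /= => -[_ u1 u2]; apply/eqP; rewrite point_eq u1 u2.
  by case: (H false r) => _ -> ->; rewrite addn0 !eqxx.
by case: (H true (~~ r)) => _ -> ->; rewrite ?addn0 ?addn1 !eqxx.
Qed.

Lemma orient_perm_cornerX v m : m \in crossings -> orient_perm v (cornerX m) =
  if crossing_sign m != (m \in v)
  then crossing_point m (~~ odd (crossing_pos m)) false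
  else crossing_point m (odd (crossing_pos m)) true.
Proof.
move=> Km; rewrite permE /next_point cornerX_in //.
have [_ _ ->] := crossing_pointP (odd (crossing_pos m)) false Km.
rewrite addn0 /cornerX; case: (odd _) => /=; first exact: down_crossing.
exact: up_crossing.
Qed.

Lemma orient_perm_cornerY v m : m \in crossings -> orient_perm v (cornerY m) =
  if crossing_sign m != (m \in v)
  then crossing_point m (odd (crossing_pos m)) true
  else crossing_point m (~~ odd (crossing_pos m)) false.
Proof.
move=> Km; rewrite permE /next_point cornerY_in //.
have [_ _ ->] := crossing_pointP (~~ odd (crossing_pos m)) true Km.
rewrite addn1 /cornerY /=; case: (odd _) => /=; first exact: up_crossing.
exact: down_crossing.
Qed.

Lemma orient_perm_swap (v v' : vertex) m : m \in crossings -> (m \in v) != (m \in v') ->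
  orient_perm v' (cornerX m) = orient_perm v (cornerY m).
Proof.
move=> Km; rewrite orient_perm_cornerX // orient_perm_cornerY //.
by case: (m \in v); case: (m \in v'); case: (crossing_sign m).
Qed.

Lemma one_resolvedU1 (m : 'I_n) (v : vertex) l : l != m :> nat ->
  one_resolved (m |: v) l = one_resolved v l.
Proof.
rewrite /one_resolved; case: insubP => //= u _ ul; rewrite -ul => h.
by rewrite in_setU1; move: h; rewrite -(inj_eq val_inj) => /negbTE ->.
Qed.

(** Only the two incoming corners step into the crossing; every other point steps along an arc that
    both resolutions share. *)
Lemma orient_permU1 m (v : vertex) : m \in crossings -> m \notin v ->
  orient_perm (m |: v) = (tperm (cornerX m) (cornerY m) * orient_perm v)%g.
Proof.
move=> Km vm; apply/permP => z; rewrite permM.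
have sw : (m \in v) != (m \in m |: v) by rewrite setU11 (negbTE vm).
case: tpermP => [-> | -> | zX zY]; first exact: orient_perm_swap.
  by apply/esym/orient_perm_swap; rewrite // eq_sym.
rewrite !permE /next_point; case Pz: (z \in P) => //.
have flE l : l != m :> nat -> flat_at (m |: v) l = flat_at v l.
  by move=> lm; rewrite /flat_at one_resolvedU1.
have acE u q : q != crossing_pos m -> q != (crossing_pos m).+1 ->
    across (flat_at u m).1 (flat_at u m).2 q = (true, q)
    /\ across (flat_at u m).2 (flat_at u m).1 q = (true, q).
  move=> q1 q2; rewrite flat_crossing //; case: (_ != _) => //=.
  by have := across_crossing q1 q2 (mem_last None [:: Some (crossing_pos m)]).
have /andP [z0 zn] := points_level Pz.
have zc (t r : bool) : z.1 = (m + t)%N :> nat -> z.2 = (crossing_pos m + r)%N :> nat ->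
    z = crossing_point m t r.
  move=> z1 z2; apply/eqP; rewrite point_eq z1 z2.
  by have [_ -> ->] := crossing_pointP t r Km; rewrite !eqxx.
(* A point that steps into the slice of m at position p or p+1 would be an incoming corner, which
   [zX] and [zY] exclude. *)
case oz: (odd z.2).
  apply: down_eq; cbv zeta; have [zm|] := eqVneq z.1.-1 m; last by move/flE => ->.
  have z1 : z.1 = (m + true)%N :> nat by rewrite addn1 -zm prednK.
  have q1 : z.2 != crossing_pos m :> nat.
    apply/eqP => z2; case: zX; rewrite /cornerX -z2 oz.
    by apply: zc; rewrite // addn0.
  have q2 : z.2 != (crossing_pos m).+1 :> nat.
    apply/eqP => z2; case: zY; rewrite /cornerY.
    have -> : odd (crossing_pos m) = false by move: oz; rewrite z2 /=; case: odd.
    by apply: zc; rewrite // addn1.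
  by rewrite zm !(proj2 (acE _ _ q1 q2)).
apply: up_eq; cbv zeta; have [zm|] := eqVneq (z.1 : nat) m; last by move/flE => ->.
have z1 : z.1 = (m + false)%N :> nat by rewrite addn0.
have q1 : z.2 != crossing_pos m :> nat.
  apply/eqP => z2; case: zX; rewrite /cornerX -z2 oz.
  by apply: zc; rewrite // addn0.
have q2 : z.2 != (crossing_pos m).+1 :> nat.
  apply/eqP => z2; case: zY; rewrite /cornerY.
  have -> : odd (crossing_pos m) = true by move: oz; rewrite z2 /=; case: odd.
  by apply: zc; rewrite // addn1.
by rewrite zm !(proj1 (acE _ _ q1 q2)).
Qed.
End Geometry.

(** * Labellings compatible with a resolution, and their edge coefficients *)

Section Colourings.
Variable E : seq (slice 0).
Hypothesis fitsE : fits_from 0 E.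

Notation P := (points E).
Notation s := (orient_perm fitsE).
Notation X := (@cornerX E).
Notation Y := (@cornerY E).
Implicit Types (v w : vertex E) (chi : {set point E}) (C : {set point E}).

(* A labelling of the circles of a resolution by the two idempotents of
   Q[x]/(x^2-1) is recorded by the set of points on the circles labelled by the
   idempotent on which x acts by -1; compatibility means that this set is a
   union of circles. *)
Definition compatible v chi : bool :=
  [&& v \subset crossings E, chi \subset P
    & [forall x in P, (s v x \in chi) == (x \in chi)]].

(** For a labelling compatible with some resolution the outgoing corners carry the colours of the
    incoming ones, so this says that all four corners agree and both resolutions of m are
    allowed. *)
Definition monochromatic (m : 'I_(size E)) chi : bool := (X m \in chi) == (Y m \in chi).

Lemma compatibleP v chi :
  reflect [/\ v \subset crossings E, chi \subset P
            & {in P, forall x, (s v x \in chi) = (x \in chi)}] (compatible v chi).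
Proof.
apply: (iffP and3P) => -[h1 h2 h3]; split=> //.
  by move=> x Px; apply/eqP/(implyP (forallP h3 x)).
by apply/forallP => x; apply/implyP => /h3 /eqP.
Qed.

Lemma compatible_orbit v chi x y : compatible v chi -> x \in P ->
  y \in porbit (s v) x -> (y \in chi) = (x \in chi).
Proof.
case/compatibleP=> _ _ h Px /porbitP [i ->].
have [_ //] : (s v ^+ i)%g x \in P /\ ((s v ^+ i)%g x \in chi) = (x \in chi).
elim: i => [|i [IH1 IH2]]; first by rewrite expg0 perm1.
by rewrite expgSr permM orient_perm_in // h.
Qed.

(** The conditions for v and v' differ only at the two incoming corners, whose successors are
    exchanged. *)
Lemma compatible_swap v v' m chi : m \in crossings E -> v' \subset crossings E ->
  s v' = (tperm (X m) (Y m) * s v)%g ->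
  compatible v chi -> compatible v' chi = monochromatic m chi.
Proof.
move=> Km Kv' E' /compatibleP [Kv Pchi h].
have PX := cornerX_in fitsE Km; have PY := cornerY_in fitsE Km.
apply/compatibleP/idP => [[_ _ h'] | /eqP mono].
  by rewrite /monochromatic -(h' _ PX) E' permM tpermL h.
split=> // x Px; rewrite E' permM h; last by case: tpermP.
by case: tpermP => [-> | -> |].
Qed.

Lemma compatibleU1 v m chi : m \in crossings E -> m \notin v ->
  compatible v chi -> compatible (m |: v) chi = monochromatic m chi.
Proof.
move=> Km vm vchi; apply: (compatible_swap (v := v)) => //.
  by rewrite subUset sub1set Km; case/and3P: vchi.
exact: orient_permU1.
Qed.

Lemma compatibleD1 v m chi : m \in v ->
  compatible v chi -> compatible (v :\ m) chi = monochromatic m chi.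
Proof.
move=> vm vchi; have Kv : v \subset crossings E by case/and3P: vchi.
have Km := subsetP Kv _ vm; apply: (compatible_swap (v := v)) => //.
  exact: subset_trans (subD1set _ _) Kv.
rewrite -{2}(setD1K vm) orient_permU1 ?setD11 //.
by rewrite mulgA tperm2 mul1g.
Qed.

(** The successors of the corners at m depend on the resolution of m alone, so v and v' may differ
    at other crossings too. *)
Lemma compatible_mono v v' m chi : compatible v chi -> compatible v' chi ->
  (m \in v) != (m \in v') -> monochromatic m chi.
Proof.
case/compatibleP=> Kv _ h /compatibleP [Kv' _ h'] mvv'.
have Km : m \in crossings E.
  by case: (boolP (m \in v)) mvv' => [/(subsetP Kv) | _ /=] //; rewrite negbK => /(subsetP Kv').
have PX := cornerX_in fitsE Km; have PY := cornerY_in fitsE Km.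
by rewrite /monochromatic -(h' _ PX) (orient_perm_swap fitsE Km mvv') h.
Qed.

Section ChangeOfResolution.
Variables (v : vertex E) (m : 'I_(size E)).
Hypotheses (Km : m \in crossings E) (vm : m \notin v).
Let w := m |: v.

(** Rules out an edge replacing one circle by one circle, on which [lee_coef] would be 0. *)
Lemma porbit_split_or_merge :
  (porbit (s w) (X m) == porbit (s w) (Y m)) = (porbit (s v) (X m) != porbit (s v) (Y m)).
Proof.
rewrite !eq_porbit_mem /w orient_permU1 // porbit_tperm_mem //.
exact: corner_neq.
Qed.

Lemma circlesDl :
  circles v :\: circles w = [set porbit (s v) (X m); porbit (s v) (Y m)].
Proof.
rewrite !(circlesE fitsE) /w orient_permU1 //.
by apply: porbit_tpermD; [exact: corner_neq | exact: cornerX_in | exact: cornerY_in].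
Qed.

Lemma circlesDr :
  circles w :\: circles v = [set porbit (s w) (X m); porbit (s w) (Y m)].
Proof.
have E1 : s v = (tperm (X m) (Y m) * s w)%g.
  by rewrite /w orient_permU1 // mulgA tperm2 mul1g.
rewrite !(circlesE fitsE) E1.
by apply: porbit_tpermD; [exact: corner_neq | exact: cornerX_in | exact: cornerY_in].
Qed.

End ChangeOfResolution.

Lemma circlesP v C : reflect (exists2 x, x \in P & C = porbit (s v) x) (C \in circles v).
Proof. by rewrite (circlesE fitsE); apply: imsetP. Qed.

Lemma circle_sub v C : C \in circles v -> C \subset P.
Proof.
case/circlesP=> x Px ->; apply/subsetP => y /porbitP [i ->].
elim: i => [|i IH]; first by rewrite expg0 perm1.
by rewrite expgSr permM orient_perm_in.
Qed.

Lemma circle_eq v C x : C \in circles v -> x \in C -> C = porbit (s v) x.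
Proof. by case/circlesP=> y Py -> xy; apply/eqP; rewrite eq_porbit_mem porbit_sym. Qed.

Lemma mem_circles v x : x \in P -> porbit (s v) x \in circles v.
Proof. by move=> Px; apply/circlesP; exists x. Qed.

Lemma circle_colour v chi C x : compatible v chi -> C \in circles v -> x \in C ->
  (C \subset chi) = (x \in chi).
Proof.
move=> vchi vC xC; have Px := subsetP (circle_sub vC) _ xC.
apply/subsetP/idP => [-> // | xchi y].
by rewrite (circle_eq vC xC) => yC; rewrite (compatible_orbit vchi Px yC).
Qed.

Lemma porbit_colour v chi x : compatible v chi -> x \in P ->
  (porbit (s v) x \subset chi) = (x \in chi).
Proof. by move=> vchi Px; apply: (circle_colour vchi (mem_circles v Px)); apply: porbit_id. Qed.

(** With inverse [cover], this identifies the labellings compatible with v with the sets of circles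
    of v, as the next three lemmas show. *)
Definition negative_circles v chi := [set C in circles v | C \subset chi].

Lemma cover_negative_circles v chi :
  compatible v chi -> cover (negative_circles v chi) = chi.
Proof.
move=> vchi; apply/setP => x; apply/bigcupP/idP => [[C] | xchi].
  by rewrite inE => /andP [_ /subsetP]; apply.
have Px : x \in P by case/compatibleP: vchi => _ /subsetP h _; apply: h.
exists (porbit (s v) x); last exact: porbit_id.
by rewrite inE mem_circles // porbit_colour.
Qed.

Lemma compatible_cover v (Z : {set {set point E}}) : v \subset crossings E ->
  Z \subset circles v -> compatible v (cover Z).
Proof.
move=> Kv Zv; apply/compatibleP; split=> //.
  by apply/bigcupsP => C /(subsetP Zv) /circle_sub.
move=> x Px; apply/bigcupP/bigcupP => -[C ZC]; have vC := subsetP Zv C ZC.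
  move=> sxC; exists C => //; rewrite (circle_eq vC sxC).
  by rewrite porbit_sym; apply: (mem_porbit _ 1).
move=> xC; exists C => //; rewrite (circle_eq vC xC).
exact: (mem_porbit _ 1).
Qed.

Lemma negative_circles_cover v (Z : {set {set point E}}) : v \subset crossings E ->
  Z \subset circles v -> negative_circles v (cover Z) = Z.
Proof.
move=> Kv Zv; have vZ := compatible_cover Kv Zv.
apply/setP => C; rewrite inE; apply/andP/idP => [[vC CZ] | ZC].
  case/circlesP: (vC) => x Px CE; have xC : x \in C by rewrite CE porbit_id.
  have /bigcupP [C' ZC' xC'] := subsetP CZ _ xC.
  by rewrite (circle_eq vC xC) -(circle_eq (subsetP Zv _ ZC') xC').
by split; [exact: (subsetP Zv) | exact: bigcup_sup].
Qed.

(* Splitting a circle multiplies the value at a labelling by 2x, merging two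
   circles does not change it. *)
Definition edge_coef v m chi : rat :=
  if porbit (s v) (X m) == porbit (s v) (Y m) then 2 * (-1) ^+ (X m \in chi) else 1.

(* The product of the edge coefficients along a path in the cube only depends
   on its ends: for each colour the number of splittings is half of the
   variation of the number of circles plus the number of crossings. *)
Definition potential v chi : rat :=
  \prod_(e : bool) (2 * (-1) ^+ e) ^+
    (#|[set C in circles v | (C \subset chi) == e]|
     + #|[set l in v | (X l \in chi) == e]|)./2.

Lemma potential_neq0 v chi : potential v chi != 0.
Proof.
apply/prodf_neq0 => e _; rewrite expf_neq0 // mulf_neq0 //.
by rewrite signr_eq0.
Qed.

(** In the colour of the corners a splitting adds a circle and a crossing, a merging trades a circle
    for a crossing. The sum grows by two or by zero, so its half behaves well whatever the
    parity. *)
Lemma half_card_step (a b : nat) (col split : bool) :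
  ((a + (if col then (~~ ~~ split).+1 else 0) + (b + col))./2
   = (a + (if col then (~~ split).+1 else 0) + b)./2 + (col && split))%N.
Proof. by case: col; case: split => /=; lia. Qed.

Lemma potential_step v m chi : m \in crossings E -> m \notin v ->
  compatible v chi -> compatible (m |: v) chi ->
  potential (m |: v) chi = edge_coef v m chi * potential v chi.
Proof.
move=> Km vm cv cw; set w := m |: v.
have mono : (X m \in chi) = (Y m \in chi).
  by apply/eqP; rewrite -[_ == _](compatibleU1 Km vm cv).
have PX := cornerX_in fitsE Km; have PY := cornerY_in fitsE Km.
pose S u e := [set C in circles u | (C \subset chi) == e].
have SD u u' (h : circles u :\: circles u' = [set porbit (s u) (X m); porbit (s u) (Y m)]) e :
    compatible u chi ->
    #|S u e| = (#|S u e :&: S u' e| + (if (X m \in chi) == e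
       then (porbit (s u) (X m) != porbit (s u) (Y m)).+1 else 0))%N.
  move=> cu; rewrite -(cardsID (S u' e)); congr (_ + _)%N.
  have -> : S u e :\: S u' e = [set C in circles u :\: circles u' | (C \subset chi) == e].
    by apply/setP => C; rewrite !inE; case: (_ == e); rewrite ?andbT ?andbF.
  rewrite h; case: ifP => Xe.
    rewrite -cards2; apply: eq_card => C; rewrite !inE.
    case: eqP => [-> | _] /=; first by rewrite porbit_colour.
    by case: eqP => [-> | _] //=; rewrite porbit_colour // -mono.
  apply/eqP; rewrite cards_eq0; apply/eqP/setP => C; rewrite !inE.
  apply/negP => /andP [/orP [] /eqP ->]; rewrite porbit_colour // ?Xe //.
  by rewrite -mono Xe.
have LU e : #|[set l in w | (X l \in chi) == e]|
    = (#|[set l in v | (X l \in chi) == e]| + ((X m \in chi) == e))%N.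
  have [<-|ne] := eqVneq (X m \in chi) e.
    rewrite [LHS](cardsD1 m) !inE eqxx /= eqxx add1n addn1; congr _.+1.
    apply: eq_card => l; rewrite !inE; case: eqVneq => [->|] //=.
    by rewrite (negbTE vm).
  rewrite addn0; apply: eq_card => l; rewrite !inE.
  by case: eqVneq => [->|] //=; rewrite (negbTE ne) (negbTE vm).
have spl := porbit_split_or_merge Km vm; rewrite -/w in spl.
have H e : (#|S w e| + #|[set l in w | (X l \in chi) == e]|)./2 =
  ((#|S v e| + #|[set l in v | (X l \in chi) == e]|)./2 +
   (((X m \in chi) == e) && (porbit (s v) (X m) == porbit (s v) (Y m))))%N.
  rewrite LU (SD w v (circlesDr Km vm) e cw) (SD v w (circlesDl Km vm) e cv) setIC.
  by rewrite spl half_card_step.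
transitivity (\prod_(e : bool) ((2 * (-1) ^+ e) ^+
     (((X m \in chi) == e) && (porbit (s v) (X m) == porbit (s v) (Y m))) *
   (2 * (-1) ^+ e) ^+ (#|S v e| + #|[set l in v | (X l \in chi) == e]|)./2) : rat).
  by rewrite /potential; apply: eq_bigr => e _; rewrite H exprD mulrC.
rewrite big_split /=; congr (_ * _); rewrite big_bool /edge_coef.
by case: (X m \in chi); case: (porbit _ _ == _); rewrite /= ?expr0 ?expr1 ?mulr1 ?mul1r.
Qed.

End Colourings.

(** * The Lee differential after evaluation at x = 1 and x = -1 *)

Lemma big_subsetsU1 (R : nmodType) (T : finType) (a : T) (S : {set T}) (F : {set T} -> R) :
  a \notin S ->
  \sum_(Z : {set T} | Z \subset a |: S) F Z
  = \sum_(Z : {set T} | Z \subset S) F Z + \sum_(Z : {set T} | Z \subset S) F (a |: Z).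
Proof.
move=> aS; rewrite (bigID (fun Z : {set T} => a \notin Z)) /=; congr (_ + _).
  apply: eq_bigl => Z; apply/andP/idP => [[/subsetP h aZ] | h].
    by apply/subsetP => x xZ; move: (h x xZ); rewrite in_setU1; case: eqP xZ aZ => [-> ->|].
  by split; [apply: subset_trans h (subsetUr _ _) | apply: contra aS; apply: subsetP h a].
rewrite (reindex_onto (fun Z => a |: Z) (fun Z => Z :\ a)) /=; last first.
  by move=> Z /andP [_]; rewrite negbK; apply: setD1K.
apply: eq_bigl => Z; rewrite setU11 /= andbT; apply/andP/idP => [[h /eqP <-] | h].
  by rewrite subDset.
rewrite setUS //; split => //; rewrite setU1K //.
by apply: contra aS; apply: subsetP h a.
Qed.

Lemma big_subsets1 (R : nmodType) (T : finType) (a : T) (F : {set T} -> R) :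
  \sum_(Z : {set T} | Z \subset [set a]) F Z = F set0 + F [set a].
Proof.
rewrite -[in X in \sum_(Z : {set T} | _ \subset X) _](setU0 [set a]) big_subsetsU1 ?inE //.
by rewrite !(big_pred1 set0) ?setU0 // => Z; rewrite subset0.
Qed.

Lemma sum_subsets_prod (R : comNzRingType) (T : finType) (S : {set T}) (t u : T -> R) :
  \sum_(Z : {set T} | Z \subset S) (\prod_(i in Z) t i * \prod_(i in S :\: Z) u i)
  = \prod_(i in S) (t i + u i).
Proof.
(* [F] vanishes off S and kills the subsets not contained in S; [G] is 1 there. *)
pose F i := if i \in S then t i else 0; pose G i := if i \in S then u i else 1.
transitivity (\prod_i (F i + G i)); last first.
  rewrite [RHS]big_mkcond; apply: eq_bigr => i _; rewrite /F /G.
  by case: ifP => //; rewrite add0r.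
rewrite bigA_distr big_mkcond; apply: eq_bigr => Z _; case: ifPn => [ZS | /subsetPn [i iZ iS]].
  rewrite [X in X * _]big_mkcond [X in _ * X]big_mkcond -big_split /=.
  apply: eq_bigr => i _; rewrite in_setD /F /G.
  case: ifP => [/(subsetP ZS) -> | _] /=; rewrite ?mulr1 ?mul1r //.
by rewrite (bigD1 i) //= iZ /F (negbTE iS) mul0r.
Qed.

Lemma prod_sign_mem (T : finType) (A B : {set T}) :
  \prod_(i in A) (-1) ^+ (i \in B) = (-1) ^+ #|A :&: B| :> rat.
Proof.
rewrite (big_setID B) /= [X in _ * X]big1 ?mulr1; last first.
  by move=> i; rewrite inE => /andP [/negbTE -> _].
rewrite (eq_bigr (fun=> -1)) ?prodr_const // => i.
by rewrite inE => /andP [_ ->].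
Qed.

Section Evaluation.
Variable E : seq (slice 0).
Hypothesis fitsE : fits_from 0 E.

Notation s := (orient_perm fitsE).
Notation X := (@cornerX E).
Notation Y := (@cornerY E).
Notation compatible := (compatible fitsE).
Implicit Types (v w : vertex E) (chi : {set point E}) (C : {set point E}) (c : chain E).

Lemma sum_gen (v : vertex E) (F : {set {set point E}} -> rat) : v \subset crossings E ->
  \sum_(g : gen E | gvertex g == v) F (gxset g)
  = \sum_(Z : {set {set point E}} | Z \subset circles v) F Z.
Proof.
move=> Kv; pose pv (Z : {set {set point E}}) := (v, Z).
transitivity (\sum_(g : gen E | (val g).1 == v) F (val g).2); first by [].
rewrite (reindex_omap (fun p => p) (fun g => Some g)) //=.
transitivity (\sum_(p : vertex E * {set {set point E}} | is_gen p && (p.1 == v)) F p.2).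
  apply/esym; rewrite (reindex_omap (val : gen E -> _) insub) /=; last first.
    by move=> p /andP [gp _]; rewrite insubT.
  by apply: eq_bigl => g; rewrite valK eqxx (valP g) !andbT.
rewrite (reindex_onto pv snd) /=; last by move=> [u Z] /andP [_ /= /eqP ->].
by apply: eq_bigl => Z; rewrite /is_gen /= Kv !eqxx !andbT.
Qed.

Definition circle_sign chi C : rat := (-1) ^+ (C \subset chi).

(** The part of c at v lies in a tensor power of Q[x]/(x^2-1), the algebra of functions on the
    labellings of the circles by 1 and -1; this is its value at the labelling [chi]. *)
Definition evaluation c v chi : rat :=
  \sum_(g : gen E | gvertex g == v) c g * \prod_(C in gxset g) circle_sign chi C.

Definition cube_sign (m : 'I_(size E)) v : rat :=
  (-1) ^+ #|[set l in v | (l < m)%N]|.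

(** On functions, merging restricts to equal labels. Splitting multiplies by the sum of the two new
    signs: 2 or -2 if they agree, and 0 if they differ, which is when [chi] is not compatible with
    v. *)
Lemma sum_frobenius_coef v m chi (a : {set {set point E}}) :
  m \in crossings E -> m \notin v -> compatible (m |: v) chi ->
  let A := circles v :\: circles (m |: v) in
  let B := circles (m |: v) :\: circles v in a \subset A ->
  \sum_(b : {set {set point E}} | b \subset B)
     (if (#|A| == 2%N) && (#|B| == 1%N) then mult_coef #|a| #|b|
      else if (#|A| == 1%N) && (#|B| == 2%N) then comult_coef #|a| #|b| else 0)
     * \prod_(C in b) circle_sign chi C
  = if compatible v chi
    then edge_coef fitsE v m chi * \prod_(C in a) circle_sign chi C else 0.
Proof.
move=> Km vm; set w := m |: v => cw A B aA.
have PX := cornerX_in fitsE Km; have PY := cornerY_in fitsE Km.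
have AE := circlesDl fitsE Km vm; have BE := circlesDr fitsE Km vm.
have spl := porbit_split_or_merge fitsE Km vm.
rewrite -/w -/A in AE; rewrite -/w -/B in BE; rewrite -/w in spl.
have cv : compatible v chi = monochromatic m chi.
  by rewrite -(compatibleD1 _ cw) ?setU11 // setU1K.
have signX u : compatible u chi -> circle_sign chi (porbit (s u) (X m)) = (-1) ^+ (X m \in chi).
  by move=> cu; rewrite /circle_sign porbit_colour.
have signY u : compatible u chi -> circle_sign chi (porbit (s u) (Y m)) = (-1) ^+ (Y m \in chi).
  by move=> cu; rewrite /circle_sign porbit_colour.
have prod_a : compatible v chi -> \prod_(C in a) circle_sign chi C
    = ((-1) ^+ (X m \in chi)) ^+ #|a|.
  move=> cv'; rewrite -prodr_const; apply: eq_bigr => C /(subsetP aA).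
  have /eqP mono : monochromatic m chi by rewrite -cv.
  by rewrite AE in_set2 => /orP [] /eqP ->; rewrite ?signX // signY // mono.
have cA : #|A| = (porbit (s v) (X m) != porbit (s v) (Y m)).+1 by rewrite AE cards2.
have cB : #|B| = (porbit (s w) (X m) != porbit (s w) (Y m)).+1 by rewrite BE cards2.
have ca := subset_leq_card aA; rewrite cA in ca.
(* [eqv] is the splitting of a circle, [neqv] the merging of two. *)
have [eqv|neqv] := eqVneq (porbit (s v) (X m)) (porbit (s v) (Y m)).
  rewrite eqv eqxx in spl; rewrite cA cB spl eqv eqxx /= BE.
  rewrite big_subsetsU1 ?in_set1 ?spl // !big_subsets1 !setU0.
  rewrite big_setU1 ?in_set1 ?spl //= !big_set1 !big_set0.
  rewrite cards0 !cards1 cards2 spl /= !signX // !signY // cv.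
  have {}ca : (#|a| <= 1)%N by rewrite eqv eqxx in ca.
  rewrite /edge_coef eqv eqxx.
  case: ifP => [mono|]; rewrite /monochromatic.
    rewrite prod_a ?cv // (eqP (mono : _ == _)).
    by case: (#|a|) ca => [|[|]] //= _; case: (_ \in chi); rewrite ?expr0 ?expr1; ring.
  case: (#|a|) ca => [|[|]] //= _; case: (_ \in chi); case: (_ \in chi) => //= _;
    by rewrite ?expr0 ?expr1; ring.
rewrite (negbTE neqv) /= in spl; have /eqP spl' := spl.
have mono : monochromatic m chi.
  by rewrite /monochromatic -(porbit_colour cw PX) spl' porbit_colour.
have {}ca : (#|a| <= 2)%N by rewrite neqv in ca.
rewrite cA cB neqv spl' eqxx /= BE spl' setUid big_subsets1 big_set0 big_set1.
rewrite cards0 cards1 -spl' signX // cv mono prod_a ?cv // /edge_coef (negbTE neqv).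
case: (#|a|) ca => [|[|[|]]] //= _; rewrite ?expr0 ?expr1; try ring.
by rewrite -exprM mulnC exprM sqrrN expr1n; ring.
Qed.

Lemma setD1_single (v w : vertex E) :
  (v \subset w) && (#|w :\: v| == 1%N) -> exists2 m, m \in w & v = w :\ m.
Proof.
case/andP=> vw /cards1P [m wvm]; exists m.
  by have /setDP [] : m \in w :\: v by rewrite wvm set11.
by rewrite -wvm setDDr setDv set0U; apply/esym/setIidPr.
Qed.

(** At most one m contributes: both sides vanish unless w arises from the vertex of g by adding one
    crossing. *)
Lemma sum_lee_coef (g : gen E) w chi : compatible w chi ->
  \sum_(h : gen E | gvertex h == w) lee_coef g h * \prod_(C in gxset h) circle_sign chi C
  = \sum_(m in w | (gvertex g == w :\ m) && compatible (w :\ m) chi)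
      cube_sign m (w :\ m) * edge_coef fitsE (w :\ m) m chi
      * \prod_(C in gxset g) circle_sign chi C.
Proof.
move=> cw; have Kw : w \subset crossings E by case/and3P: cw.
case: (boolP ((gvertex g \subset w) && (#|w :\: gvertex g| == 1%N))) => [|no].
  case/setD1_single=> m wm gm.
  have Km := subsetP Kw _ wm.
  set v := w :\ m in gm *; have vm : m \notin v by rewrite setD11.
  have wE : w = m |: v by rewrite setD1K.
  have wv : w :\: v = [set m] by rewrite wE setDUl setDv setU0; apply/setDidPl; rewrite disjoints1.
  rewrite (eq_bigl (fun l => (l == m) && compatible v chi)); last first.
    move=> l; have [-> | lm] := eqVneq l m; first by rewrite wm gm eqxx.
    apply/negP => /andP [wl /andP [/eqP gl _]].
    have : m \notin w :\ l by rewrite -gl gm setD11.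
    by rewrite !inE wm andbT negbK eq_sym (negbTE lm).
  transitivity (cube_sign m v * (if compatible v chi then
     edge_coef fitsE v m chi * \prod_(C in gxset g) circle_sign chi C else 0)); last first.
    case: ifP => cv; last by rewrite mulr0 big_pred0 // => l; rewrite andbF.
    by rewrite (big_pred1 m) ?mulrA // => l; rewrite andbT.
  set A := circles v :\: circles w; set B := circles w :\: circles v.
  (* [a] holds the labels x on circles touched by the edge, [d] those on the spectators; the
     possible targets are d together with a subset of B. *)
  set a := gxset g :&: A; set d := gxset g :\: A.
  pose coef (x y : nat) := if (#|A| == 2%N) && (#|B| == 1%N) then mult_coef x y
    else if (#|A| == 1%N) && (#|B| == 2%N) then comult_coef x y else 0.
  transitivity (\sum_(h : gen E | gvertex h == w) (if d == gxset h :\: B then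
     cube_sign m v * coef #|a| #|gxset h :&: B| else 0) *
     \prod_(C in gxset h) circle_sign chi C).
    apply: eq_bigr => h /eqP hw; rewrite /lee_coef hw gm -/A -/B -/d wv cards1 eqxx /=.
    rewrite subD1set /=; case: ifP => // _; congr (_ * _ * _); congr (_ ^+ #|pred_of_set _|).
    apply/setP => l; rewrite !inE; congr (_ && _).
    apply/existsP/idP => [[x]|lm]; first by rewrite in_set1 => /andP [/eqP ->].
    by exists m; rewrite set11.
  rewrite (sum_gen (fun Z => (if d == Z :\: B then cube_sign m v * coef #|a| #|Z :&: B| else 0)
    * \prod_(C in Z) circle_sign chi C)) //.
  have dB : [disjoint d & B].
    rewrite -setI_eq0; apply/eqP/setP => C; rewrite !inE.
    have := valP g; rewrite /is_gen -/(gxset g) -/(gvertex g) gm => /andP [_ /subsetP gC].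
    by case: (boolP (C \in gxset g)) => [/gC -> | _]; rewrite ?andbF //=; case: (_ \in _).
  transitivity (\sum_(b : {set {set point E}} | b \subset B)
     cube_sign m v * \prod_(C in d) circle_sign chi C *
     (coef #|a| #|b| * \prod_(C in b) circle_sign chi C)).
    rewrite (eq_bigr (fun Z : {set {set point E}} => if d == Z :\: B then
      cube_sign m v * coef #|a| #|Z :&: B| * \prod_(C in Z) circle_sign chi C else 0)); last first.
      by move=> Z _; case: ifP; rewrite ?mul0r.
    rewrite -big_mkcondr /= (reindex_onto (fun b => d :|: b) (fun Z => Z :&: B)) /=; last first.
      by move=> Z /andP [_ /eqP ->]; rewrite setUC setID.
    have dw : d \subset circles w.
      have := valP g; rewrite /is_gen -/(gxset g) -/(gvertex g) gm => /andP [_ /subsetP gC].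
      apply/subsetP => C; rewrite !inE => /andP [nA /gC Cv].
      by move: nA; rewrite Cv andbT negbK.
    have DB : d :\: B = d by apply/setDidPl.
    have IB : d :&: B = set0 by apply/eqP; rewrite setI_eq0.
    have bE (b : {set {set point E}}) : b \subset B ->
        (d :|: b) :\: B = d /\ (d :|: b) :&: B = b.
      move=> bB; rewrite setDUl DB setIUl IB set0U (setIidPl bB); split=> //.
      by move: bB; rewrite -setD_eq0 => /eqP ->; rewrite setU0.
    rewrite (eq_bigl (fun b : {set {set point E}} => b \subset B)); last first.
      move=> b; apply/idP/idP => [/andP [_ /eqP <-]|bB]; first exact: subsetIr.
      have [-> ->] := bE b bB; rewrite !eqxx subUset dw !andbT /=.
      by apply: subset_trans bB (subsetDl _ _).
    apply: eq_bigr => b bB; have [b1 b2] := bE b bB.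
    rewrite b2 [X in _ * X = _](big_setID B) /= b1 b2; ring.
  rewrite -big_distrr /=.
  have -> : \prod_(C in gxset g) circle_sign chi C =
      \prod_(C in d) circle_sign chi C * \prod_(C in a) circle_sign chi C.
    by rewrite (big_setID A) mulrC.
  rewrite wE in cw; have := sum_frobenius_coef Km vm cw (subsetIr (gxset g) _).
  rewrite -wE -/A -/B -/a => ->.
  by case: ifP => _; rewrite ?mulr0 //; ring.
rewrite [RHS]big_pred0.
  rewrite big1 // => h /eqP hw.
  by rewrite /lee_coef hw andbA (negbTE no) /= mul0r.
move=> m; apply/negP => /andP [wm /andP [/eqP gm _]]; case/negP: no.
by rewrite gm subD1set setDDr setDv set0U (setIidPr _) ?sub1set ?cards1.
Qed.

Lemma lee_diffE c (h : gen E) : lee_diff E c h = \sum_g c g * lee_coef g h.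
Proof.
pose f (c' : chain E) : chain E := [ffun h => \sum_g c' g * lee_coef g h].
have f_lin : linear f.
  move=> a c1 c2; apply/ffunP => k; rewrite !ffunE scaler_sumr -big_split /=.
  by apply: eq_bigr => g _; rewrite !ffunE mulrDl -scalerAl.
(* [linfun] returns the given function only when that function is linear, so linearity is
   established first. *)
pose fL := HB.pack_for {linear chain E -> chain E} f (GRing.isLinear.Build _ _ _ _ f f_lin).
by rewrite /lee_diff -[linfun _]/(linfun fL) lfunE ffunE.
Qed.

(** This is the splitting of the complex: the value of the differential at [chi] involves values of
    c at the same [chi] only. *)
Lemma evaluation_diff c w chi : compatible w chi ->
  evaluation (lee_diff E c) w chi
  = \sum_(m in w | compatible (w :\ m) chi)
      cube_sign m (w :\ m) * edge_coef fitsE (w :\ m) m chi * evaluation c (w :\ m) chi.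
Proof.
move=> cw; rewrite /evaluation.
transitivity (\sum_g c g * (\sum_(h | gvertex h == w)
    lee_coef g h * \prod_(C in gxset h) circle_sign chi C)).
  under eq_bigr => h _ do rewrite lee_diffE mulr_suml.
  rewrite exchange_big /=; apply: eq_bigr => g _; rewrite mulr_sumr.
  by apply: eq_bigr => h _; rewrite mulrA.
under eq_bigr => g _ do rewrite sum_lee_coef // mulr_sumr.
under [RHS]eq_bigr => m _ do rewrite mulr_sumr.
rewrite (exchange_big_dep (fun m => (m \in w) && compatible (w :\ m) chi)) /=; last first.
  by move=> g m _ /andP [-> /andP [_ ->]].
apply: eq_bigr => m /andP [wm cm].
by apply: eq_big => g; rewrite ?wm ?cm ?andbT // mulrCA.
Qed.

End Evaluation.

(** Orthogonality of the characters of the group of subsets of S: a point where A and B differ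
    contributes the factor -1 + 1. *)
Lemma sum_subsets_sign (T : finType) (S A B : {set T}) : A \subset S -> B \subset S ->
  \sum_(Z : {set T} | Z \subset S) \prod_(i in Z) ((-1) ^+ (i \in A) * (-1) ^+ (i \in B))
  = (if A == B then 2 ^+ #|S| else 0) :> rat.
Proof.
move=> AS BS.
transitivity (\prod_(i in S) ((-1) ^+ (i \in A) * (-1) ^+ (i \in B) + 1) : rat).
  rewrite -sum_subsets_prod; apply: eq_bigr => Z _.
  by rewrite [X in _ * X]big1 ?mulr1.
case: eqVneq => [<- | AB].
  by rewrite -prodr_const; apply: eq_bigr => i _; rewrite -expr2 sqrr_sign.
have [i iS iAB] : exists2 i, i \in S & (i \in A) != (i \in B).
  apply/exists_inP; apply: contraNT AB => /exists_inPn h; apply/eqP/setP => i.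
  case: (boolP (i \in S)) => [/h | iS]; first by rewrite negbK => /eqP.
  by rewrite (contraNF (subsetP AS i) iS) (contraNF (subsetP BS i) iS).
rewrite (bigD1 i) //=.
by case: (i \in A) iAB; case: (i \in B) => //= _; rewrite ?expr0 ?expr1 ?mulr1 ?mul1r addNr mul0r.
Qed.

(** * The normalised Fourier transform of chains *)

Section Transform.
Variable E : seq (slice 0).
Hypothesis fitsE : fits_from 0 E.

Notation compatible := (compatible fitsE).
Notation potential := (@potential E).
Implicit Types (v w : vertex E) (chi : {set point E}) (C : {set point E}) (c : chain E).

(** Dividing by the potential turns every edge coefficient into 1 and leaves the signs of the cube.
    The value 0 at incompatible pairs lets sums over edges run without side conditions. *)
Definition transform c v chi : rat :=
  if compatible v chi then evaluation c v chi / potential v chi else 0.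

Lemma transform_diff c w chi : transform (lee_diff E c) w chi =
  if compatible w chi then \sum_(m in w) cube_sign m (w :\ m) * transform c (w :\ m) chi
  else 0.
Proof.
rewrite /transform; case: ifP => // cw; have Kw : w \subset crossings E by case/and3P: cw.
rewrite (evaluation_diff _ cw) mulr_suml big_mkcondr; apply: eq_bigr => m wm.
case: ifP => cm; last by rewrite mulr0.
have vm : m \notin w :\ m by rewrite setD11.
have := potential_step (subsetP Kw _ wm) vm cm; rewrite setD1K // => /(_ cw) pE.
have := potential_neq0 w chi; rewrite pE mulf_eq0 negb_or => /andP [e0 p0].
by field; rewrite e0 p0.
Qed.

Lemma transformD a c1 c2 v chi :
  transform (a *: c1 + c2) v chi = a * transform c1 v chi + transform c2 v chi.
Proof.
rewrite /transform; case: ifP => _; last by rewrite mulr0 addr0.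
rewrite mulrA -mulrDl; congr (_ / _); rewrite /evaluation mulr_sumr -big_split /=.
by apply: eq_bigr => g _; rewrite !ffunE mulrDl mulrA.
Qed.

Lemma circle_sign_cover v (Z : {set {set point E}}) C : v \subset crossings E ->
  Z \subset circles v -> C \in circles v -> circle_sign (cover Z) C = (-1) ^+ (C \in Z).
Proof.
move=> Kv Zv Cv; rewrite /circle_sign.
by have := negative_circles_cover fitsE Kv Zv; move/setP/(_ C); rewrite inE Cv /= => ->.
Qed.

Lemma sum_circle_sign v (A B : {set {set point E}}) : v \subset crossings E ->
  A \subset circles v -> B \subset circles v ->
  \sum_(Z : {set {set point E}} | Z \subset circles v)
    (\prod_(C in A) circle_sign (cover Z) C * \prod_(C in B) (-1) ^+ (C \in Z))
  = if A == B then 2 ^+ #|circles v| else 0.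
Proof.
move=> Kv Av Bv; rewrite -sum_subsets_sign //; apply: eq_bigr => Z Zv.
rewrite (eq_bigr (fun C => (-1) ^+ (C \in Z))); last first.
  by move=> C /(subsetP Av) Cv; apply: (circle_sign_cover Kv Zv).
by rewrite big_split /= !prod_sign_mem setIC [B :&: Z]setIC.
Qed.

(** Fourier inversion: summing the evaluations at v against the character of [g0] leaves a power of
    2 times the coefficient of [g0]. *)
Lemma transform_eq0 c : (forall v chi, transform c v chi = 0) -> c = 0.
Proof.
move=> c0; apply/ffunP => g0; rewrite ffunE; set v := gvertex g0.
have /andP [Kv0 gv] := valP g0; rewrite -/(gvertex g0) -/v -/(gxset g0) in Kv0 gv.
have Kv : v \subset crossings E by [].
have ev0 (Z : {set {set point E}}) : Z \subset circles v -> evaluation c v (cover Z) = 0.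
  move=> Zv; have := c0 v (cover Z); rewrite /transform compatible_cover //.
  by move/eqP; rewrite mulf_eq0 invr_eq0 (negbTE (potential_neq0 _ _)) orbF => /eqP.
have : \sum_(Z : {set {set point E}} | Z \subset circles v)
   evaluation c v (cover Z) * \prod_(C in gxset g0) (-1) ^+ (C \in Z) = 0.
  by rewrite big1 // => Z /ev0 ->; rewrite mul0r.
under eq_bigr => Z _ do rewrite mulr_suml.
rewrite exchange_big /= (eq_bigr (fun g => c g *
    (if gxset g == gxset g0 then 2 ^+ #|circles v| else 0))); last first.
  move=> g /eqP gv'; have /andP [_ gv''] := valP g.
  rewrite -/(gvertex g) gv' -/(gxset g) in gv''.
  rewrite -sum_circle_sign // mulr_sumr; apply: eq_bigr => Z _.
  by rewrite mulrA.
rewrite (bigD1 g0) //= eqxx [X in _ + X]big1 ?addr0.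
  by move/eqP; rewrite mulf_eq0 (negbTE (expf_neq0 _ _)) // orbF => /eqP.
move=> g /andP [/eqP gv' gg0]; case: eqP => gx; last by rewrite mulr0.
case/eqP: gg0; apply: val_inj; move: gv' gx; rewrite /v /gvertex /gxset.
by case: (val g) => a b; case: (val g0) => a' b' /= -> ->.
Qed.

(** The inverse transform, vertex by vertex; the potential undoes the division in [transform]. *)
Definition chain_of (phi : vertex E -> {set point E} -> rat) : chain E :=
  [ffun g => let v := gvertex g in (2 ^+ #|circles v|)^-1 *
     \sum_(Z : {set {set point E}} | Z \subset circles v)
        potential v (cover Z) * phi v (cover Z) * \prod_(C in gxset g) (-1) ^+ (C \in Z)].

Lemma transform_chain_of phi v chi : transform (chain_of phi) v chi =
  if compatible v chi then phi v chi else 0.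
Proof.
rewrite /transform; case: ifP => // cv; have Kv : v \subset crossings E by case/and3P: cv.
pose Z0 := negative_circles v chi.
have Z0v : Z0 \subset circles v by apply/subsetP => C; rewrite inE => /andP [].
have covE : cover Z0 = chi by apply: cover_negative_circles cv.
pose F (A : {set {set point E}}) : rat := (2 ^+ #|circles v|)^-1 *
     (\sum_(Z : {set {set point E}} | Z \subset circles v)
        potential v (cover Z) * phi v (cover Z) * \prod_(C in A) (-1) ^+ (C \in Z)) *
     \prod_(C in A) circle_sign (cover Z0) C.
have -> : evaluation (chain_of phi) v chi =
    \sum_(A : {set {set point E}} | A \subset circles v) F A.
  rewrite -sum_gen //; apply: eq_bigr => g /eqP gv.
  by rewrite /F /chain_of ffunE gv covE.
rewrite /F; under eq_bigr => A _ do rewrite mulr_sumr mulr_suml.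
rewrite exchange_big /= (eq_bigr (fun Z => (2 ^+ #|circles v|)^-1 *
   (potential v (cover Z) * phi v (cover Z)) * (if Z == Z0 then 2 ^+ #|circles v| else 0))).
  rewrite (bigD1 Z0) //= eqxx [X in _ + X]big1 ?addr0; last first.
    by move=> Z /andP [_ /negbTE ->]; rewrite mulr0.
  have n0 : 2 ^+ #|circles v| != 0 :> rat by rewrite expf_neq0.
  rewrite covE; move: (potential_neq0 v chi) n0.
  move: (potential v chi) (2 ^+ _) (phi v chi) => p q f p0 q0.
  by field; rewrite p0 q0.
move=> Z Zv; rewrite -sum_subsets_sign // mulr_sumr; apply: eq_bigr => A Av.
rewrite -!mulrA; congr (_ * (_ * (_ * _))); rewrite big_split /=; congr (_ * _).
by apply: eq_bigr => C /(subsetP Av); apply: (circle_sign_cover Kv Z0v).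
Qed.

Lemma transform_neq0 c v chi : transform c v chi != 0 ->
  compatible v chi /\ exists2 g, gvertex g = v & c g != 0.
Proof.
rewrite /transform; case: ifP => [cv|]; last by rewrite eqxx.
rewrite mulf_eq0 negb_or => /andP [ev0 _]; split=> //.
have [/exists_inP [g /eqP gv cg] | /exists_inPn h] :=
  boolP [exists (g : gen E | gvertex g == v), c g != 0]; first by exists g.
case/eqP: ev0; rewrite /evaluation big1 // => g gv.
by have := h g gv; rewrite negbK => /eqP ->; rewrite mul0r.
Qed.

(** * The square of the differential, and the contraction of the acyclic summands *)

Section Homology.
Variable o : seq bool.
Notation hdeg := (hdeg o).

Lemma graded_pieceP j c :
  reflect (forall g, c g != 0 -> hdeg g = j) (c \in graded_piece E o j).
Proof.
apply: (iffP idP) => [cj g cg | h].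
  apply/eqP; apply: contraNT cg => gj; rewrite /graded_piece in cj.
  set s := [seq basis_chain g | g : gen E in _] in cj.
  rewrite (coord_span (X := in_tuple s) cj) sum_ffunE big1 // => i _.
  rewrite !ffunE; have /mapP [k] : (in_tuple s)`_i \in s by apply: mem_nth; apply: ltn_ord.
  rewrite mem_enum inE => /eqP kj ->; rewrite ffunE.
  by have [gk|] := eqVneq g k; rewrite ?scaler0 //; rewrite gk kj eqxx in gj.
have -> : c = \sum_(g | hdeg g == j) c g *: basis_chain g.
  apply/ffunP => g; rewrite sum_ffunE.
  have [gj | gj] := eqVneq (hdeg g) j.
    rewrite (bigD1 g) /= ?gj ?eqxx // big1 ?addr0.
      by rewrite !ffunE eqxx; apply/esym/mulr1.
    by move=> k /andP [_ kg]; rewrite !ffunE eq_sym (negbTE kg); apply: mulr0.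
  rewrite big1 => [|k kj]; first by apply/eqP; apply: contraNT gj => /h ->.
  rewrite !ffunE; have [gk|] := eqVneq g k; last by move=> _; apply: mulr0.
  by rewrite gk kj in gj.
apply: memv_suml => g gj; apply/memvZ/memv_span/mapP; exists g => //.
by rewrite mem_enum.
Qed.

Lemma lee_diff_graded j c : c \in graded_piece E o (j - 1) -> lee_diff E c \in graded_piece E o j.
Proof.
move=> /graded_pieceP h; apply/graded_pieceP => k.
rewrite lee_diffE => dk; have [/exists_inP [g _] | /exists_inPn h0] :=
  boolP [exists (g : gen E | true), c g * lee_coef g k != 0]; last first.
  by case/eqP: dk; rewrite big1 // => g _; have := h0 g isT; rewrite negbK => /eqP.
rewrite mulf_eq0 negb_or => /andP [/h gj]; rewrite /lee_coef.
case: ifP => [/and3P [vw /eqP c1 _] _ | _]; last by rewrite eqxx.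
move: gj; rewrite /Defs.hdeg -(cardsID (gvertex g) (gvertex k)) (setIidPr vw) c1.
by rewrite PoszD => gj; lia.
Qed.

Lemma cube_signU1 (m l : 'I_(size E)) v : l \notin v ->
  cube_sign m (l |: v) = cube_sign m v * (-1) ^+ (l < m)%N.
Proof.
move=> lv; rewrite /cube_sign -exprD addnC; congr (_ ^+ _).
have -> : [set x in l |: v | (x < m)%N] =
    if (l < m)%N then l |: [set x in v | (x < m)%N] else [set x in v | (x < m)%N].
  apply/setP => x; case: ifP => lm; rewrite !inE; case: eqP => [->|] //=; rewrite lm //.
  by rewrite andbF.
by case: ifP => lm //; rewrite cardsU1 inE (negbTE lv).
Qed.

Lemma transform0 v chi : transform 0 v chi = 0.
Proof.
rewrite /transform; case: ifP => // _; rewrite /evaluation big1 ?mul0r // => g _.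
by rewrite ffunE mul0r.
Qed.

Lemma cube_sign_sqr (m : 'I_(size E)) v : cube_sign m v * cube_sign m v = 1.
Proof. by rewrite -expr2 sqrr_sign. Qed.

(** Exactly one of [l < m] and [m < l] holds, so the two paths around a square differ by a sign. *)
Lemma cube_sign_anticomm (m l : 'I_(size E)) v : m != l -> m \notin v -> l \notin v ->
  cube_sign l v * cube_sign m (l |: v) = - (cube_sign m v * cube_sign l (m |: v)).
Proof.
move=> ml mv lv; rewrite !cube_signU1 //.
have : (m : nat) != l by [].
by case: ltngtP => //= _ _; rewrite ?expr0 ?expr1; ring.
Qed.

(** After the transform the double sum is antisymmetric in the two removed crossings, hence equal to
    its own opposite. *)
Lemma lee_diff_sqr c : lee_diff E (lee_diff E c) = 0.
Proof.
apply: transform_eq0 => w chi; rewrite transform_diff; case: ifP => // cw.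
pose G (m l : 'I_(size E)) : rat := if [&& m \in w, l \in w & l != m] then
  cube_sign m (w :\ m) * (cube_sign l (w :\ m :\ l) * transform c (w :\ m :\ l) chi) else 0.
transitivity (\sum_m \sum_l G m l).
  rewrite big_mkcond; apply: eq_bigr => m _; rewrite /G.
  case: ifP => wm /=; last by rewrite big1.
  rewrite transform_diff; case: ifP => cm.
    rewrite mulr_sumr [LHS]big_mkcond; apply: eq_bigr => l _.
    by rewrite in_setD1 andbC.
  rewrite mulr0 big1 // => l _; case: ifP => // /andP [wl lm].
  (* A nonzero term would make both ends of the square compatible, hence m monochromatic and the
     middle vertex compatible as well. *)
  have [-> | /transform_neq0 [cml _]] := eqVneq (transform c (w :\ m :\ l) chi) 0.
    by rewrite !mulr0.
  have := compatible_mono (m := m) cw cml; rewrite wm !inE eqxx andbF => /(_ isT).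
  by rewrite -(compatibleD1 wm cw) cm.
set S := \sum_m _; suff : S = - S by move: S => S0 h; lra.
rewrite {1}/S exchange_big -sumrN; apply: eq_bigr => m _; rewrite -sumrN.
apply: eq_bigr => l _; rewrite /G.
have -> : [&& m \in w, l \in w & l != m] = [&& l \in w, m \in w & m != l].
  by rewrite andbCA eq_sym.
case: ifP => [/and3P [wl wm ml]|]; last by rewrite oppr0.
have lm : l != m by rewrite eq_sym.
set u := w :\ m :\ l; have uE : w :\ l :\ m = u by rewrite /u !setDDl setUC.
rewrite uE.
have <- : l |: u = w :\ m by rewrite /u setD1K // !inE lm.
have <- : m |: u = w :\ l by rewrite -uE setD1K // !inE ml.
have mu : m \notin u by rewrite !inE eqxx andbF.
have lu : l \notin u by rewrite !inE eqxx.
have h := cube_sign_anticomm ml mu lu.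
by rewrite !mulrA -mulNr; congr (_ * _); rewrite [in RHS]mulrC h opprK mulrC.
Qed.

(* Inverts the edges of the cube in the direction of one monochromatic crossing,
   chosen as a function of the labelling alone. *)
Definition homotopy c v chi : rat :=
  if [pick m in crossings E | monochromatic m chi] is Some m then
    if m \in v then 0 else cube_sign m v * transform c (m |: v) chi
  else 0.

(** [homotopy] contracts the summand of every labelling with a monochromatic crossing; on the other
    summands c vanishes by hypothesis. *)
Lemma cycle_boundary j c : c \in cycles E o j ->
  (forall v chi, compatible v chi ->
     (forall m, m \in crossings E -> ~~ monochromatic m chi) -> transform c v chi = 0) ->
  c \in boundaries E o j.
Proof.
rewrite /cycles memv_cap memv_ker => /andP [/graded_pieceP cj /eqP dc] h.
pose e := chain_of (homotopy c).
have -> : c = lee_diff E e.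
  apply/eqP; rewrite -subr_eq0 addrC -scaleN1r; apply/eqP/transform_eq0 => w chi.
  rewrite transformD mulN1r; apply/eqP; rewrite addrC subr_eq0; apply/eqP.
  rewrite transform_diff; case: ifP => cw; last by rewrite /transform cw.
  rewrite (eq_bigr (fun m => cube_sign m (w :\ m) *
     (if compatible (w :\ m) chi then homotopy c (w :\ m) chi else 0))); last first.
    by move=> m _; rewrite transform_chain_of.
  rewrite /homotopy; case: pickP => [m /andP [Km mono] | none]; last first.
    rewrite h // => [|m Km]; last by have := none m; rewrite Km /= => ->.
    by rewrite big1 // => m _; case: ifP; rewrite mulr0.
  (* If m lies in w, [homotopy] vanishes at all the neighbours still containing m, and the edge in
     direction m returns the value of c at w. *)
  have [wm | wm] := boolP (m \in w).
    rewrite (bigD1 m) //= compatibleD1 // mono setD11 setD1K // mulrA cube_sign_sqr mul1r.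
    rewrite big1 ?addr0 // => l /andP [wl lm].
    by rewrite !inE eq_sym lm wm /=; case: ifP; rewrite mulr0.
  (* The cycle condition at [m |: w] is solved for the value at w; anticommutativity then matches
     the remaining edges. *)
  have := transform_diff c (m |: w) chi; rewrite dc transform0 compatibleU1 // mono.
  rewrite (bigD1 m) ?setU11 //= setU1K // => /eqP; rewrite eq_sym addr_eq0 => /eqP E1.
  rewrite -[LHS]mul1r -(cube_sign_sqr m w) -mulrA E1 mulrN mulr_sumr -sumrN.
  apply: eq_big => [l|l /andP [lmw lm]].
    by rewrite !inE; case: eqVneq => [->|] /=; rewrite ?(negbTE wm) ?andbF ?andbT.
  have wl : l \in w by move: lmw; rewrite !inE (negbTE lm).
  set u := w :\ l; have -> : (m |: w) :\ l = m |: u.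
    by apply/setP => x; rewrite !inE; case: (eqVneq x m) => [->|] //=; rewrite eq_sym lm.
  have mu : m \notin u by rewrite !inE (negbTE wm) andbF.
  have lu : l \notin u by rewrite !inE eqxx.
  have ml : m != l by rewrite eq_sym.
  have := cube_sign_anticomm ml mu lu; have -> : l |: u = w by rewrite setD1K.
  rewrite (negbTE mu); case: ifP => cu.
    move=> ac; rewrite -mulNr !mulrA; congr (_ * _).
    rewrite -[LHS]mulr1 -(cube_sign_sqr m u).
    transitivity (cube_sign m w * (- (cube_sign m u * cube_sign l (m |: u))) * cube_sign m u).
      by ring.
    rewrite -ac.
    transitivity ((cube_sign m w * cube_sign m w) * (cube_sign l u * cube_sign m u)).
      by ring.
    by rewrite cube_sign_sqr mul1r.
  have [-> _ | /transform_neq0 [cmu _]] := eqVneq (transform c (m |: u) chi) 0.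
    by rewrite !mulr0 oppr0.
  have := compatible_mono (m := l) cw cmu; rewrite wl !inE eqxx (negbTE lm) => /(_ isT).
  by rewrite -(compatibleD1 wl cw) -/u cu.
(* The preimage is supported one degree lower, as its value at v is read from c at [m |: v]. *)
apply: memv_img; apply/graded_pieceP => g; rewrite ffunE mulf_eq0 negb_or => /andP [_ S0].
have [/exists_inP [Z _] | /exists_inPn h0] :=
  boolP [exists (Z : {set {set point E}} | true), homotopy c (gvertex g) (cover Z) != 0]; last first.
  case/eqP: S0; rewrite big1 // => Z _; have := h0 Z isT; rewrite negbK => /eqP ->.
  by rewrite mulr0 mul0r.
rewrite /homotopy; case: pickP => [m /andP [Km mono] | none]; last by rewrite eqxx.
case: ifP => [|vm]; first by rewrite eqxx.
rewrite mulf_eq0 negb_or => /andP [_ /transform_neq0 [_ [g' g'v /cj]]].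
rewrite /Defs.hdeg g'v cardsU1 vm PoszD => g'j; lia.
Qed.

(** Without monochromatic crossings no edge joins two vertices compatible with [chi]. *)
Lemma boundary_transform j c v chi : c \in boundaries E o j ->
  (forall m, m \in crossings E -> ~~ monochromatic m chi) -> transform c v chi = 0.
Proof.
case/memv_imgP=> e _ -> h; rewrite transform_diff; case: ifP => // cv.
rewrite big1 // => m vm; rewrite /transform compatibleD1 //.
have Km : m \in crossings E by case/compatibleP: cv => /subsetP Kv _ _; apply: Kv.
by rewrite (negbTE (h m Km)) mulr0.
Qed.

Lemma boundaries_cycles j : (boundaries E o j <= cycles E o j)%VS.
Proof.
apply/subvP => _ /memv_imgP [e ej ->]; rewrite memv_cap memv_ker lee_diff_sqr eqxx andbT.
exact: lee_diff_graded.
Qed.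

End Homology.

End Transform.

(** * Circles, levels and orientations *)

Opaque up down crossing_point.

Section Levels.
Variable E : seq (slice 0).
Hypothesis fitsE : fits_from 0 E.

Notation n := (size E).
Notation P := (points E).
Notation s := (orient_perm fitsE).
Notation width := (width E).
Notation compatible := (compatible fitsE).
Implicit Types (v : vertex E) (chi C : {set point E}).

Definition occupies C (l q : nat) : bool :=
  [exists x in C, (x.1 == l :> nat) && (x.2 == q :> nat)].

Lemma occupiesE C (x : point E) : occupies C x.1 x.2 = (x \in C).
Proof.
apply/exists_inP/idP => [[y yC] | xC]; last by exists x; rewrite ?eqxx.
by rewrite -point_eq => /eqP <-.
Qed.

Lemma point_at l q : (l <= n)%N -> (q < width l)%N ->
  exists2 x : point E, x \in P & x.1 = l :> nat /\ x.2 = q :> nat.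
Proof.
move=> ln ql; have n0 : (0 < n.*2)%N by have := width_le fitsE ln; lia.
have [Px x1 x2] := mkpointP fitsE (ord0 : 'I_n.+1, Ordinal n0) ln ql.
by exists (mkpoint (ord0, Ordinal n0) l q).
Qed.

Lemma compatible_symadj v chi x y : compatible v chi -> x \in P -> symadj v x y ->
  (y \in chi) = (x \in chi).
Proof.
move=> /compatibleP [_ _ h] Px xy; have Py : y \in P by rewrite -(symadj_in fitsE xy).
by move: xy; rewrite (symadj_perm fitsE) // => /orP [] /eqP ->; rewrite h.
Qed.

Lemma symadj_up v x : x \in P -> symadj v x (up v x).
Proof. by move=> Px; rewrite symadjE // eqxx. Qed.

Lemma symadj_down v x : x \in P -> symadj v x (down v x).
Proof. by move=> Px; rewrite symadjE // eqxx orbT. Qed.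

Lemma across_turn1 a p : across (Some p) a p = (false, p.+1).
Proof. by rewrite /= eqxx. Qed.

Lemma compatible_through v chi l q q' : compatible v chi -> (l < n)%N -> (q < width l)%N ->
  across (flat_at v l).1 (flat_at v l).2 q = (true, q') ->
  occupies chi l.+1 q' = occupies chi l q.
Proof.
move=> cv ln ql a; have [x Px [xl xq]] := point_at (ltnW ln) ql.
have := upP fitsE v Px; cbv zeta; rewrite xl xq a => -[_ /= y1 y2].
by rewrite -y1 -y2 -xl -xq !occupiesE (compatible_symadj cv Px (symadj_up v Px)).
Qed.

Lemma compatible_turn_up v chi l p : compatible v chi -> (l < n)%N ->
  (flat_at v l).1 = Some p -> occupies chi l p.+1 = occupies chi l p.
Proof.
move=> cv ln fp.
have pl : (p < width l)%N.
  have [u [-> _]] := flat_width fitsE (one_resolved v l) ln.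
  by rewrite -/(flat_at v l) fp; lia.
have [x Px [xl xq]] := point_at (ltnW ln) pl.
have := upP fitsE v Px; cbv zeta; rewrite xl xq fp across_turn1 => -[_ /= y1 y2].
by rewrite -[X in occupies _ X p.+1]y1 -y2 -xl -xq !occupiesE (compatible_symadj cv Px (symadj_up v Px)).
Qed.

Lemma compatible_turn_down v chi l p : compatible v chi -> (l < n)%N ->
  (flat_at v l).2 = Some p -> occupies chi l.+1 p.+1 = occupies chi l.+1 p.
Proof.
move=> cv ln fp.
have pl : (p < width l.+1)%N.
  have [u [_ -> _]] := flat_width fitsE (one_resolved v l) ln.
  by rewrite -/(flat_at v l) fp; lia.
have [x Px [xl xq]] := point_at ln pl.
have := downP fitsE v Px; cbv zeta; rewrite xl xq /= fp across_turn1 => -[_ /= y1 y2].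
by rewrite -[X in occupies _ X p.+1]y1 -y2 -xl -xq !occupiesE (compatible_symadj cv Px (symadj_down v Px)).
Qed.

Lemma across_turnP a a' q q' : across a a' q = (false, q') ->
  exists2 p, a = Some p & (q = p /\ q' = p.+1) \/ (q = p.+1 /\ q' = p).
Proof.
case: a => [p|] //=; case: eqP => [-> [<-]|_]; first by exists p => //; left.
by case: eqP => [-> [<-]|_] //; exists p => //; right.
Qed.

(** Induction along a circle, arc by arc. It serves for the colour of an orientation, for enclosure
    by another circle and for the sense of rotation. *)
Lemma circle_invariant v C (beta : nat -> nat -> bool) : C \in circles v ->
  (forall l, (l < n)%N -> let f := flat_at v l in
    [/\ forall q q', (q < width l)%N -> across f.1 f.2 q = (true, q') ->
          occupies C l q -> beta l.+1 q' = beta l q,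
        forall p, f.1 = Some p -> occupies C l p -> beta l p.+1 = beta l p
      & forall p, f.2 = Some p -> occupies C l.+1 p -> beta l.+1 p.+1 = beta l.+1 p]) ->
  {in C &, forall x y : point E, beta x.1 x.2 = beta y.1 y.2}.
Proof.
move=> vC H.
have CP := circle_sub fitsE vC.
have step x : x \in C -> s v x \in C -> beta (s v x).1 (s v x).2 = beta x.1 x.2.
  move=> xC; have Px := subsetP CP _ xC; have /andP [x0 xn] := points_level fitsE Px.
  rewrite permE /next_point Px; case: ifP => _ yC.
    have x1n : (x.1.-1 < n)%N by lia.
    have [thr _ tdn] := H _ x1n.
    have := downP fitsE v Px; cbv zeta; have := yC; move: (down v x) => y {}yC [_].
    case a: (across _ _ _) => [[] q'] /= y1 y2.
      have := acrossK a; rewrite -y2 => /= b.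
      have Py := subsetP CP _ yC; rewrite in_points y1 in Py.
      have := thr _ _ Py b; rewrite -y1 occupiesE => /(_ yC) <-.
      by rewrite y1 prednK.
    have [p fp E2] := across_turnP a; have := tdn p fp; rewrite prednK // y1 y2.
    case: E2 => [[xp yp]|[xp yp]].
      by rewrite xp yp; apply; rewrite -xp occupiesE.
    by rewrite xp yp => -> //; rewrite -y1 -yp -y2 occupiesE.
  have [thr tup _] := H _ xn.
  have := upP fitsE v Px; cbv zeta; have := yC; move: (up v x) => y {}yC [_].
  case a: (across _ _ _) => [[] q'] /= y1 y2.
    have xw : (x.2 < width x.1)%N by rewrite -in_points.
    by rewrite y1 y2; apply: thr a _; rewrite ?occupiesE.
  have [p fp E2] := across_turnP a; have := tup p fp; rewrite y1 y2.
  case: E2 => [[xp yp]|[xp yp]].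
    by rewrite xp yp; apply; rewrite -xp occupiesE.
  by rewrite xp yp => -> //; rewrite -y1 -yp -y2 occupiesE.
move=> x y xC yC; have := yC; rewrite (circle_eq fitsE vC xC) => /porbitP [i ->].
have [_ //] : ((s v ^+ i)%g x \in C) /\ beta x.1 x.2 = beta ((s v ^+ i)%g x).1 ((s v ^+ i)%g x).2.
elim: i => [|i [IH1 IH2]]; first by rewrite expg0 perm1.
have sC : (s v ^+ i.+1)%g x \in C by rewrite (circle_eq fitsE vC xC) mem_porbit.
by split => //; move: sC; rewrite expgSr permM => sC; rewrite step.
Qed.

(** The two skipped positions contribute equal terms, hence an even amount. *)
Lemma skip_sum_parity (a : option nat) (gamma : nat -> bool) m :
  (forall p, a = Some p -> gamma p.+1 = gamma p) ->
  odd (\sum_(i < skip a m) gamma i) = odd (\sum_(j < m) gamma (skip a j)).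
Proof.
case: a => [p|] h; last by [].
have {}h := h p erefl; elim: m => [|m IH].
  rewrite big_ord0 /=; case: ltnP => [|p0]; first by rewrite big_ord0.
  move: h; have -> : p = 0%N by lia.
  by rewrite !big_ord_recr big_ord0 /= => ->; case: (gamma _).
rewrite big_ord_recr oddD -IH /=; case: (ltngtP m.+1 p) => mp.
- by rewrite big_ord_recr /= oddD.
- by rewrite big_ord_recr /= oddD.
- rewrite !big_ord_recr /= !oddD mp h -mp.
  by case: (gamma m.+1); rewrite ?addbF // -addbA addbb addbF.
Qed.

Lemma skip_leq a j m : (j <= m)%N -> (skip a j <= skip a m)%N.
Proof. by rewrite /skip; case: a => [p|] //; do 2!case: ifP; lia. Qed.

Lemma skip_ge a m : (m < (skip a m).+1)%N.
Proof. by rewrite /skip; case: a => [p|] //; case: ifP; lia. Qed.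

Definition left_count C l q : nat := \sum_(i < q) occupies C l i.

Lemma left_ofE C (x : point E) : left_of C x = left_count C x.1 x.2.
Proof.
rewrite /left_of /left_count -sum1dep_card.
rewrite (big_ord_widen n.*2 (fun i => occupies C x.1 i : nat)) ?(ltnW (ltn_ord x.2)) //.
rewrite (partition_big (fun y : point E => y.2) (fun i : 'I_(n.*2) => (i < x.2)%N)) /=; last first.
  by move=> y /and3P [].
apply: eq_bigr => i ix; rewrite sum1dep_card.
have [/exists_inP [y yC /andP [/eqP y1 /eqP y2]] | no] := boolP (occupies C x.1 i).
  apply: etrans (cards1 y); apply: eq_card => z; rewrite !inE point_eq.
  apply/idP/idP.
    by move=> /andP [/and3P [zC /eqP z1 z2] /eqP zi]; rewrite z1 zi y1 y2 !eqxx.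
  move=> /andP [/eqP z1 /eqP z2].
  have -> : z = y by apply/eqP; rewrite point_eq z1 z2 !eqxx.
  by rewrite yC -!(inj_eq val_inj) /= y1 y2 ix !eqxx.
apply/eqP; rewrite cards_eq0; apply/eqP/setP => z; rewrite !inE.
apply/negP => /andP [/and3P [zC z1 z2] zi]; case/negP: no.
by apply/exists_inP; exists z; rewrite // -!(inj_eq val_inj) in z1 zi *; rewrite z1 zi.
Qed.

Lemma compatible_circle v C : v \subset crossings E -> C \in circles v -> compatible v C.
Proof.
move=> Kv vC; have := @compatible_cover _ fitsE v [set C] Kv.
by rewrite sub1set vC /cover big_set1; apply.
Qed.

(** The strands of C on the left that turn in this slice appear or disappear in pairs. *)
Lemma left_count_parity v C l q q' : compatible v C -> (l < n)%N -> (q < width l)%N ->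
  across (flat_at v l).1 (flat_at v l).2 q = (true, q') ->
  odd (left_count C l.+1 q') = odd (left_count C l q).
Proof.
move=> cv ln ql a; have : through (flat_at v l) q q' by rewrite through_across a eqxx.
case/existsP=> m /andP [/eqP qE /eqP q'E]; rewrite qE q'E /left_count !skip_sum_parity.
- congr odd; apply: eq_bigr => j _; congr nat_of_bool.
  apply: (compatible_through cv ln).
    apply: leq_ltn_trans ql.
    apply: leq_trans (_ : skip (flat_at v l).1 m <= q)%N; last by rewrite -qE.
    exact: skip_leq (ltnW (ltn_ord j)).
  apply/eqP; rewrite -through_across; apply/existsP.
  by exists (Ordinal (skip_ge _ _)); rewrite /= !eqxx.
- by move=> p; apply: compatible_turn_up cv ln.
- by move=> p; apply: compatible_turn_down cv ln.
Qed.

(** Each of the strands to the left of x lies on exactly one circle. *)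
Lemma sum_left_of v (x : point E) : x \in P -> (\sum_(C in circles v) left_of C x = x.2)%N.
Proof.
move=> Px; under eq_bigr => C _ do rewrite left_ofE.
rewrite /left_count exchange_big /= -[RHS]card_ord -sum1_card; apply: eq_bigr => i _.
have /andP [x0 xn] := points_level fitsE Px.
have iw : (i < width x.1)%N by apply: ltn_trans (ltn_ord i) _; rewrite -in_points.
have [y Py [<- <-]] := point_at (ltnW xn) iw.
under eq_bigr => C _ do rewrite occupiesE.
rewrite (bigD1 (porbit (s v) y)) ?mem_circles //= porbit_id big1 // => C /andP [vC Cy].
by apply/eqP; rewrite eqb0; apply: contraNN Cy => yC; rewrite (circle_eq fitsE vC yC).
Qed.

End Levels.

Lemma nth_splice (T : Type) (x0 : T) (st a : seq T) p k q : (p <= size st)%N ->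
  nth x0 (take p st ++ a ++ drop k st) q =
  if (q < p)%N then nth x0 st q
  else if (q < p + size a)%N then nth x0 a (q - p)
  else nth x0 st (k + (q - p - size a))%N.
Proof.
move=> ps; rewrite !nth_cat size_takel //; case: ltnP => qp; first by rewrite nth_take.
by rewrite ltn_subLR //; case: ltnP => // qa; rewrite nth_drop.
Qed.

(** * Propagation of directions from level to level *)

Section Directions.
Variable r : nat.
Implicit Types (s : slice r) (D : seq (slice r)) (o st : seq bool).

Definition dir_step s st o : seq bool :=
  match s with
  | Cup p => take p st ++ [:: head true o; ~~ head true o] ++ drop p st
  | Cap p => take p st ++ [::] ++ drop p.+2 st
  | Cross p _ => take p st ++ [:: nth true st p.+1; nth true st p] ++ drop p.+2 st
  | Arc _ _ _ => st
  end.

Definition bits_step s o : seq bool := if is_cup s then behead o else o.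

Lemma dirs_from_cons s D st o :
  dirs_from (s :: D) st o = st :: dirs_from D (dir_step s st o) (bits_step s o).
Proof. by case: s. Qed.

Lemma nth_dirs0 D st o : nth [::] (dirs_from D st o) 0 = st.
Proof. by case: D => [|s D]; rewrite ?dirs_from_cons. Qed.

Lemma nth_dirsS s0 D st o l : (l < size D)%N ->
  nth [::] (dirs_from D st o) l.+1 =
  dir_step (nth s0 D l) (nth [::] (dirs_from D st o) l)
    (drop (count (@is_cup r) (take l D)) o).
Proof.
elim: D st o l => [|s D IH] st o l //; rewrite ltnS dirs_from_cons.
case: l => [|l] lD; first by rewrite [LHS]/= nth_dirs0 drop0.
rewrite [LHS]/= IH //= /bits_step; congr (dir_step _ _ _).
by case: (is_cup s); rewrite ?add0n // add1n -drop1 drop_drop addn1.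
Qed.

Lemma size_dir_step s st o : fits (size st) s -> size (dir_step s st o) = next_width (size st) s.
Proof.
case: s => [p|p|p b|i p m] //= h; rewrite !size_cat ?size_takel /= ?size_drop; lia.
Qed.

End Directions.

(** * The colouring of an orientation and its Lee generator *)

Section Orientations.
Variable E : seq (slice 0).
Hypothesis fitsE : fits_from 0 E.
Variable o : seq bool.

Notation n := (size E).
Notation P := (points E).
Notation width := (width E).
Notation compatible := (compatible fitsE).
Notation dir := (dir E o).
Notation level l := (nth [::] (dirs_from E [::] o) l).
Notation bits l := (drop (count (@is_cup 0) (take l E)) o).

Lemma size_level l : (l <= n)%N -> size (level l) = width l.
Proof.
elim: l => [|l IH] ln; first by rewrite nth_dirs0.
have [fl ->] := widthS fitsE ln.
by rewrite (nth_dirsS slice0) // size_dir_step IH // ltnW.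
Qed.

Lemma dir_cup l p : (l < n)%N -> nth slice0 E l = Cup 0 p ->
  [/\ dir l.+1 p = head true (bits l), dir l.+1 p.+1 = ~~ head true (bits l)
    & forall q, (q < width l)%N -> dir l.+1 (skip (Some p) q) = dir l q].
Proof.
move=> ln sl; have [fl _] := widthS fitsE ln; rewrite sl /= in fl.
have pl : (p <= size (level l))%N by rewrite size_level // ltnW.
rewrite /Defs.dir (nth_dirsS slice0) // sl /dir_step !nth_splice //.
split=> [||q ql]; rewrite ?nth_splice //=.
- by rewrite ltnn addn2 ltnS leqnSn subnn.
- by rewrite ltnNge leqnSn addn2 ltnSn subSnn.
- case: (ltnP q p) => qp; rewrite ?qp //.
  by do 2![case: ifP; first lia]; move=> _ _; congr nth; lia.
Qed.

Lemma dir_cap l p q : (l < n)%N -> nth slice0 E l = Cap 0 p ->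
  dir l.+1 q = dir l (skip (Some p) q).
Proof.
move=> ln sl; have [fl _] := widthS fitsE ln; rewrite sl /= in fl.
have pl : (p <= size (level l))%N by rewrite size_level; lia.
rewrite /Defs.dir (nth_dirsS slice0) // sl /dir_step !nth_splice //= addn0.
by case: (ltnP q p) => qp //; congr nth; lia.
Qed.

Lemma dir_cross l p c : (l < n)%N -> nth slice0 E l = Cross 0 p c ->
  [/\ dir l.+1 p = dir l p.+1, dir l.+1 p.+1 = dir l p
    & forall q, q != p -> q != p.+1 -> dir l.+1 q = dir l q].
Proof.
move=> ln sl; have [fl _] := widthS fitsE ln; rewrite sl /= in fl.
have pl : (p <= size (level l))%N by rewrite size_level; lia.
rewrite /Defs.dir (nth_dirsS slice0) // sl /dir_step !nth_splice //.
split=> [||q qp qp1]; rewrite ?nth_splice //=.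
- by rewrite ltnn addn2 ltnS leqnSn subnn.
- by rewrite ltnNge leqnSn addn2 ltnSn subSnn.
- case: (ltnP q p) => h //; case: ifP => h'; first by lia.
  by congr nth; lia.
Qed.

(** True where the orientation disagrees with the alternating one, in which even strands go up and
    odd ones down. *)
Definition orientation_colour l q : bool := odd q (+) ~~ dir l q.

Definition orientation_colouring : {set point E} :=
  [set x in P | orientation_colour x.1 x.2].

Notation v := (oriented_resolution E o).

Hypothesis coh : coherent E o.

Lemma oriented_resolution_sub : v \subset crossings E.
Proof.
by apply/subsetP => l; rewrite !inE /is_negative /is_crossing; case: (slice_at l).
Qed.

Lemma coherent_cap l p : (l < n)%N -> nth slice0 E l = Cap 0 p -> dir l p != dir l p.+1.
Proof.
move=> ln sl; have := forallP coh (Ordinal ln).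
by rewrite (tnth_nth slice0) /= sl.
Qed.

Lemma flat_oriented l p c : (l < n)%N -> nth slice0 E l = Cross 0 p c ->
  flat_at v l = if dir l p == dir l p.+1 then (None, None) else (Some p, Some p).
Proof.
move=> ln sl; rewrite -[l]/(nat_of_ord (Ordinal ln)) -flat_atE inE /is_negative.
rewrite /slice_at (tnth_nth slice0) /= sl /=.
by case: c {sl}; case: (dir l p); case: (dir l p.+1).
Qed.

Lemma flat_cup w l p : nth slice0 E l = Cup 0 p -> flat_at (w : vertex E) l = (None, Some p).
Proof. by rewrite /flat_at /flat => ->. Qed.

Lemma flat_cap w l p : nth slice0 E l = Cap 0 p -> flat_at (w : vertex E) l = (Some p, None).
Proof. by rewrite /flat_at /flat => ->. Qed.

Lemma oriented_through l q q' : (l < n)%N -> (q < width l)%N ->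
  across (flat_at v l).1 (flat_at v l).2 q = (true, q') -> dir l.+1 q' = dir l q.
Proof.
move=> ln ql; case sl: (nth slice0 E l) => [p|p|p c|[]//].
- by rewrite (flat_cup _ sl) /= => -[<-]; have [_ _ ->] := dir_cup ln sl.
- rewrite (flat_cap _ sl) /= (dir_cap _ ln sl).
  case: eqP => // q1; case: eqP => // q2 -[<-]; congr (dir l _).
  by rewrite /skip; repeat case: ifP; lia.
- rewrite (flat_oriented ln sl); have [d1 d2 d3] := dir_cross ln sl.
  case: eqP => dE.
    rewrite /= => -[<-]; have [->|qp] := eqVneq q p; first by rewrite d1.
    by have [->|qp1] := eqVneq q p.+1; rewrite ?d2 // d3.
  rewrite /=; case: eqVneq => // q1; case: eqVneq => // q2 -[<-].
  rewrite -(d3 q) //; congr (dir _ _).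
  by rewrite /skip; repeat case: ifP; lia.
Qed.

Lemma oriented_turn_up l p : (l < n)%N -> (flat_at v l).1 = Some p -> dir l p.+1 = ~~ dir l p.
Proof.
move=> ln; case sl: (nth slice0 E l) => [p'|p'|p' c|[]//].
- by rewrite (flat_cup _ sl).
- rewrite (flat_cap _ sl) => -[<-]; have := coherent_cap ln sl.
  by case: (dir l p'); case: (dir l p'.+1).
- rewrite (flat_oriented ln sl); case: ifP => // /negbT h [<-]; move: h.
  by case: (dir l p'); case: (dir l p'.+1).
Qed.

Lemma oriented_turn_down l p : (l < n)%N -> (flat_at v l).2 = Some p ->
  dir l.+1 p.+1 = ~~ dir l.+1 p.
Proof.
move=> ln; case sl: (nth slice0 E l) => [p'|p'|p' c|[]//].
- by rewrite (flat_cup _ sl) => -[<-]; have [-> ->] := dir_cup ln sl.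
- by rewrite (flat_cap _ sl).
- rewrite (flat_oriented ln sl); case: ifP => // /negbT h [<-]; move: h.
  have [-> -> _] := dir_cross ln sl.
  by case: (dir l p'); case: (dir l p'.+1).
Qed.

Lemma in_orientation_colouring (x : point E) : x \in P ->
  (x \in orientation_colouring) = orientation_colour x.1 x.2.
Proof. by move=> Px; rewrite inE Px. Qed.

(** Both the given and the alternating orientation orient each circle of the oriented resolution, so
    they agree on all of it or nowhere. *)
Lemma circle_orientation_colour C : C \in circles v ->
  {in C &, forall x y : point E, orientation_colour x.1 x.2 = orientation_colour y.1 y.2}.
Proof.
move=> vC; apply: (circle_invariant fitsE vC) => l ln; split=> [q q' ql a _ | p fp _ | p fp _];
  rewrite /orientation_colour.
- rewrite (oriented_through ln ql a).
  by have := across_parity (flat_at v l).1 (flat_at v l).2 q; rewrite a /= negbK => ->.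
- by rewrite (oriented_turn_up ln fp) /= negbK addNb addbN.
- by rewrite (oriented_turn_down ln fp) /= negbK addNb addbN.
Qed.

Lemma compatible_orientation : compatible v orientation_colouring.
Proof.
apply/compatibleP; split; first exact: oriented_resolution_sub.
  by apply/subsetP => x; rewrite inE => /andP [].
move=> x Px; rewrite !in_orientation_colouring ?orient_perm_in //.
apply: (circle_orientation_colour (mem_circles fitsE v Px)); last exact: porbit_id.
exact: (mem_porbit _ 1).
Qed.

Lemma nth_crossing m : m \in crossings E ->
  exists c, nth slice0 E m = Cross 0 (crossing_pos m) c.
Proof.
rewrite inE /is_crossing /crossing_pos /slice_at (tnth_nth slice0) /=.
by case: (nth _ _ _) => // p c; exists c.
Qed.

(** The two corners are the ends of one strand of the link, which enters the crossing at one and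
    leaves at the other, whereas both are incoming in the alternating orientation. *)
Lemma orientation_not_mono m : m \in crossings E -> ~~ monochromatic m orientation_colouring.
Proof.
move=> Km; have [c sm] := nth_crossing Km.
have [d1 d2 _] := dir_cross (ltn_ord m) sm.
rewrite /monochromatic !in_orientation_colouring ?cornerX_in ?cornerY_in // /orientation_colour.
have [_ -> ->] := crossing_pointP fitsE (odd (crossing_pos m)) false Km.
have [_ -> ->] := crossing_pointP fitsE (~~ odd (crossing_pos m)) true Km.
rewrite addn0 addn1 /=; case: (odd _); rewrite /= ?addn0 ?addn1 ?d1 ?d2; by case: (dir _ _).
Qed.

Lemma odd_sum_card (T : finType) (A : {set T}) (f : T -> nat) :
  odd (\sum_(i in A) f i) = odd #|[set i in A | odd (f i)]|.
Proof.
rewrite -sum1dep_card big_mkcondr /= !(big_morph odd oddD erefl).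
by apply: eq_bigr => i _; case: (odd (f i)).
Qed.

(** Makes [encloses] independent of the point chosen on C. At a turn of C only a strand of C is
    added on the left, and it does not belong to C'. *)
Lemma left_of_invariant C C' : C \in circles v -> C' \in circles v -> C' != C ->
  {in C &, forall x y : point E, odd (left_of C' x) = odd (left_of C' y)}.
Proof.
move=> vC vC' neC x y xC yC; rewrite !left_ofE.
apply: (circle_invariant fitsE vC (beta := fun l q => odd (left_count C' l q))) xC yC => l ln.
have c' := compatible_circle fitsE oriented_resolution_sub vC'.
have c := compatible_circle fitsE oriented_resolution_sub vC.
have disj k q : occupies C k q -> occupies C' k q = false.
  case/exists_inP=> z zC /andP [/eqP <- /eqP <-]; rewrite occupiesE.
  apply/negP => zC'; case/eqP: neC.
  by rewrite (circle_eq fitsE vC zC) -(circle_eq fitsE vC' zC').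
split=> [q q' ql a _ | p fp Cp | p fp Cp].
- exact: (left_count_parity c' ln ql a).
- by rewrite /left_count big_ord_recr /= (disj _ _ Cp) addn0.
- by rewrite /left_count big_ord_recr /= (disj _ _ Cp) addn0.
Qed.

(** At a turn of C the direction and the parity of the count change together. *)
Lemma counterclockwise_invariant C : C \in circles v ->
  {in C &, forall x y : point E, (dir x.1 x.2 == odd (left_of C x))
    = (dir y.1 y.2 == odd (left_of C y))}.
Proof.
move=> vC x y xC yC; rewrite !left_ofE.
apply: (circle_invariant fitsE vC (beta := fun l q => dir l q == odd (left_count C l q))) xC yC => l ln.
have c := compatible_circle fitsE oriented_resolution_sub vC.
split=> [q q' ql a _ | p fp Cp | p fp Cp].
- by rewrite (left_count_parity c ln ql a) (oriented_through ln ql a).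
- rewrite (oriented_turn_up ln fp) /left_count big_ord_recr /= Cp addn1 /=.
  by case: (dir _ _); case: (odd _).
- rewrite (oriented_turn_down ln fp) /left_count big_ord_recr /= Cp addn1 /=.
  by case: (dir _ _); case: (odd _).
Qed.

(* z_index counts, modulo 2, the circles around the region on the left hand side
   of the oriented strand at x, and each strand on the left of x contributes one
   crossing of the boundary of exactly one circle. *)
Lemma odd_z_index C x : C \in circles v -> x \in C ->
  odd (z_index o C) = orientation_colour x.1 x.2.
Proof.
move=> vC xC; have Px := subsetP (circle_sub fitsE vC) _ xC.
have cE : counterclockwise o C = (dir x.1 x.2 == odd (left_of C x)) :> bool.
  apply/exists_inP/idP => [[y yC] | h]; last by exists x.
  by rewrite (counterclockwise_invariant vC yC xC).
have sumE := sum_left_of fitsE v Px; rewrite (bigD1 C) //= in sumE.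
rewrite /z_index cE /orientation_colour -sumE !oddD.
have -> : (\sum_(C' in circles v | C' != C) left_of C' x =
    \sum_(C' in circles v :\ C) left_of C' x)%N.
  by apply: eq_bigl => C'; rewrite in_setD1 andbC.
rewrite odd_sum_card.
have -> : [set C' in circles v | encloses C' C] = [set C' in circles v :\ C | odd (left_of C' x)].
  apply/setP => C'; rewrite !inE /encloses -!andbA; case: eqVneq => //= [|neC].
    by rewrite andbF.
  case vC' : (C' \in circles v) => //=; apply/exists_inP/idP => [[y yC]|h]; last by exists x.
  by rewrite (left_of_invariant vC vC' neC yC xC).
by rewrite oddb; case: (odd #|_|); case: (odd _); case: (dir _ _).
Qed.

Lemma evaluation_lee_gen w chi : evaluation (lee_gen E o) w chi =
  if w == v then \prod_(C in circles v) (circle_sign chi C + (-1) ^+ z_index o C) else 0.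
Proof.
rewrite /evaluation; case: eqVneq => [-> | wv]; last first.
  by rewrite big1 // => g /eqP gw; rewrite ffunE gw (negbTE wv) mul0r.
rewrite -sum_subsets_prod -(sum_gen (fun Z => \prod_(C in Z) circle_sign chi C *
  \prod_(C in circles v :\: Z) (-1) ^+ z_index o C)) ?oriented_resolution_sub //.
by apply: eq_bigr => g /eqP gv; rewrite ffunE gv eqxx mulrC.
Qed.

(** Each circle contributes a sum of two signs, its colour in [chi] and, by [odd_z_index], its
    colour in the colouring of o; the product is nonzero iff all these colours agree. *)
Lemma transform_lee_gen w chi : compatible w chi ->
  (transform fitsE (lee_gen E o) w chi != 0) = (w == v) && (chi == orientation_colouring).
Proof.
move=> cw; rewrite /transform cw mulf_eq0 invr_eq0 (negbTE (potential_neq0 _ _)) orbF.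
rewrite evaluation_lee_gen; case: (boolP (w == v)) => [/eqP wv|_] /=; last by [].

rewrite wv in cw; have co := compatible_orientation.
have zE C : C \in circles v -> (-1) ^+ z_index o C = circle_sign orientation_colouring C :> rat.
  move=> vC; case/(circlesP fitsE): (vC) => x Px CE; have xC : x \in C by rewrite CE porbit_id.
  rewrite /circle_sign (circle_colour co vC xC) in_orientation_colouring //.
  by rewrite -(odd_z_index vC xC) signr_odd.
apply/prodf_neq0/eqP => [h | -> C vC]; last first.
  by rewrite zE // -mulr2n mulrn_eq0 signr_eq0.
rewrite -(cover_negative_circles cw) -(cover_negative_circles co); congr cover.
apply/setP => C; rewrite !inE; case vC : (C \in circles v) => //=.
have := h C vC; rewrite zE // /circle_sign.
by do 2!case: (C \subset _) => //; rewrite ?expr0 ?expr1 ?addNr ?subrr eqxx.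
Qed.

End Orientations.

(** * From colourings back to orientations *)

Section FilteredIota.
Variables (T : Type) (x0 : T) (p : pred T) (D : seq T).

Lemma size_filter_iota l : (l <= size D)%N ->
  size [seq i <- iota 0 l | p (nth x0 D i)] = count p (take l D).
Proof. by move=> lD; rewrite size_filter -(map_nth_iota0 x0 lD) count_map. Qed.

Lemma nth_map_filter_iota (S : Type) (d : S) (F : nat -> S) l : (l < size D)%N -> p (nth x0 D l) ->
  nth d [seq F i | i <- iota 0 (size D) & p (nth x0 D i)] (count p (take l D)) = F l.
Proof.
move=> lD pl; have -> : iota 0 (size D) = iota 0 l ++ l :: iota l.+1 (size D - l.+1).
  by rewrite -[l :: _]/(iota l (size D - l.+1).+1) -iotaD; congr iota; lia.
by rewrite filter_cat map_cat nth_cat size_map (size_filter_iota (ltnW lD)) ltnn subnn /= pl.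
Qed.

Lemma map_nth_filter_iota (S : Type) (d : S) (o : seq S) : size o = count p D ->
  [seq nth d o (count p (take l D)) | l <- iota 0 (size D) & p (nth x0 D l)] = o.
Proof.
move=> so; suff H k : (k <= size D)%N ->
    [seq nth d o (count p (take l D)) | l <- iota 0 k & p (nth x0 D l)]
    = take (count p (take k D)) o.
  by rewrite H // take_size -so take_size.
elim: k => [|k IH] kD; first by rewrite !take0.
rewrite -addn1 iotaD filter_cat map_cat IH ?(ltnW kD) // add0n addn1 (take_nth x0) //.
rewrite -cats1 count_cat /= addn0; case pk: (p _) => /=; last by rewrite cats0 addn0.
rewrite addn1 (take_nth d) ?cats1 // so -[X in (_ < count _ X)%N](cat_take_drop k D) count_cat.
by rewrite (drop_nth x0) //= pk; lia.
Qed.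

End FilteredIota.

Section OrientationOfColouring.
Variable E : seq (slice 0).
Hypothesis fitsE : fits_from 0 E.

Notation n := (size E).
Notation P := (points E).
Notation width := (width E).
Notation compatible := (compatible fitsE).

Definition cup_pos l : nat := if nth slice0 E l is Cup p then p else 0%N.

(** [orientation_colour] solved for the direction. *)
Definition colour_dir (chi : {set point E}) l q : bool := odd q (+) ~~ occupies chi l q.

Definition colour_bits chi : seq bool :=
  [seq colour_dir chi l.+1 (cup_pos l) | l <- iota 0 n & is_cup (nth slice0 E l)].

Lemma size_colour_bits chi : size (colour_bits chi) = count (@is_cup 0) E.
Proof. by rewrite size_map size_filter_iota // take_size. Qed.

Lemma head_bits (o : seq bool) k : head true (drop k o) = nth true o k.
Proof. by rewrite -nth0 nth_drop addn0. Qed.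

Section Colouring.
Variables (v : vertex E) (chi : {set point E}).
Hypothesis cv : compatible v chi.
Hypothesis no_mono : forall m, m \in crossings E -> ~~ monochromatic m chi.

Notation o := (colour_bits chi).
Notation cdir := (colour_dir chi).
Notation dir := (dir E o).

Lemma colour_dir_through l q q' : (l < n)%N -> (q < width l)%N ->
  across (flat_at v l).1 (flat_at v l).2 q = (true, q') -> cdir l.+1 q' = cdir l q.
Proof.
move=> ln ql a; rewrite /colour_dir (compatible_through cv ln ql a).
by have := across_parity (flat_at v l).1 (flat_at v l).2 q; rewrite a /= negbK => ->.
Qed.

Lemma colour_dir_turn_up l p : (l < n)%N -> (flat_at v l).1 = Some p -> cdir l p.+1 = ~~ cdir l p.
Proof. by move=> ln fp; rewrite /colour_dir (compatible_turn_up cv ln fp) addNb. Qed.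

Lemma colour_dir_turn_down l p : (l < n)%N -> (flat_at v l).2 = Some p ->
  cdir l.+1 p.+1 = ~~ cdir l.+1 p.
Proof. by move=> ln fp; rewrite /colour_dir (compatible_turn_down cv ln fp) addNb. Qed.

Lemma flat_cross l p c : (l < n)%N -> nth slice0 E l = Cross 0 p c ->
  flat_at v l = if c != one_resolved v l then (None, None) else (Some p, Some p).
Proof. by move=> ln sl; rewrite /flat_at /flat sl. Qed.

(** The different colours of the incoming corners force the directions to continue diagonally, as on
    a link, and make v resolve the crossing along them. *)
Lemma colour_dir_cross l p c : (l < n)%N -> nth slice0 E l = Cross 0 p c ->
  [/\ cdir l.+1 p = cdir l p.+1, cdir l.+1 p.+1 = cdir l p
    & (cdir l p == cdir l p.+1) = (c != one_resolved v l)].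
Proof.
move=> ln sl; pose m := Ordinal ln.
have [fl _] := widthS fitsE ln; rewrite sl /= in fl.
have Km : m \in crossings E by rewrite inE /is_crossing /slice_at (tnth_nth slice0) /= sl.
have pm : crossing_pos m = p by rewrite /crossing_pos /slice_at (tnth_nth slice0) /= sl.
have := no_mono Km; rewrite /monochromatic -!occupiesE.
have [_ -> ->] := crossing_pointP fitsE (odd (crossing_pos m)) false Km.
have [_ -> ->] := crossing_pointP fitsE (~~ odd (crossing_pos m)) true Km.
rewrite pm addn0 addn1 /=.
have thr := compatible_through cv ln; have tup := compatible_turn_up cv ln.
have tdn := compatible_turn_down cv ln.
rewrite /colour_dir /= (flat_cross ln sl) in thr tup tdn *.
case: (c != _) thr tup tdn => /= thr tup tdn.
  have t1 := thr p p (ltnW fl) erefl; have t2 := thr p.+1 p.+1 fl erefl.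
  case: (odd p); rewrite /= ?addn0 ?addn1 ?t1 ?t2;
    by case: (occupies _ l p); case: (occupies _ l p.+1).
have t1 := tup p erefl; have t2 := tdn p erefl.
case: (odd p); rewrite /= ?addn0 ?addn1 ?t1 ?t2;
    by case: (occupies _ l p); case: (occupies _ l.+1 p).
Qed.

(** Induction on the level: [colour_dir] obeys the rules by which [dirs_from] propagates directions,
    and the bits were read off at the minima. *)
Lemma colour_dirE l q : (l <= n)%N -> (q < width l)%N -> dir l q = cdir l q.
Proof.
elim: l q => [|l IH] q ln // ql; have [fl wl] := widthS fitsE ln.
have {}IH q' := IH q' (ltnW ln); rewrite wl in ql.
case sl: (nth slice0 E l) => [p|p|p c|[]//]; rewrite sl /= in fl ql.
- have [d1 d2 d3] := dir_cup fitsE o ln sl.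
  have bE : head true (drop (count (@is_cup 0) (take l E)) o) = cdir l.+1 p.
    rewrite head_bits (nth_map_filter_iota true (fun l => cdir l.+1 (cup_pos l)) ln) ?sl //.
    by rewrite /cup_pos sl.
  have [->|qp] := eqVneq q p; first by rewrite d1.
  have [->|qp1] := eqVneq q p.+1.
    by rewrite d2 bE (@colour_dir_turn_down l) // (flat_cup _ sl).
  have qE : q = skip (Some p) (unskip (Some p) q).
    by rewrite /skip /unskip; repeat case: ifP; lia.
  have uq : (unskip (Some p) q < width l)%N by rewrite /unskip; case: ifP; lia.
  rewrite {1}qE d3 // IH //; apply/esym/(@colour_dir_through l) => //.
  by rewrite (flat_cup _ sl); apply: (congr1 (pair true) (esym qE)).
- have sw : (skip (Some p) q < width l)%N by rewrite /skip; case: ifP; lia.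
  rewrite (dir_cap fitsE o _ ln sl) IH //; apply/esym/(@colour_dir_through l) => //.
  rewrite (flat_cap _ sl).
  by have := @acrossK None (Some p) q true (skip (Some p) q) erefl.
- have [d1 d2 d3] := dir_cross fitsE o ln sl.
  have [c1 c2 _] := colour_dir_cross ln sl.
  have [->|qp] := eqVneq q p; first by rewrite d1 IH.
  have [->|qp1] := eqVneq q p.+1; first by rewrite d2 IH ?c2 // ltnW.
  rewrite d3 // IH //; apply/esym/(@colour_dir_through l) => //.
  rewrite (flat_cross ln sl); case: (_ != _) => //.
  have := across_crossing (a := Some p) qp qp1; rewrite !inE eqxx orbT; exact.
Qed.

Lemma coherent_colour_bits : coherent E o.
Proof.
apply/forallP => l; rewrite (tnth_nth slice0) /=.
case sl: (nth slice0 E l) => [p|p|p c|[]//] //.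
have [fl _] := widthS fitsE (ltn_ord l); rewrite sl /= in fl.
rewrite !colour_dirE ?(ltnW (ltn_ord l)) // ?(ltnW fl) //.
rewrite (@colour_dir_turn_up l) ?(flat_cap _ sl) //.
by case: (cdir _ _).
Qed.

Lemma oriented_resolution_colour_bits : oriented_resolution E o = v.
Proof.
apply/setP => m; rewrite inE /is_negative.
have -> : (m \in v) = one_resolved v m by rewrite one_resolved_ord.
case sl: (slice_at m) => [p|p|p c|[]//].
1,2: by apply/esym/negbTE; rewrite one_resolved_ord; apply/negP => vm;
  case/compatibleP: cv => /subsetP /(_ m vm); rewrite inE /is_crossing sl.
rewrite /slice_at (tnth_nth slice0) /= in sl.
have [fl _] := widthS fitsE (ltn_ord m); rewrite sl /= in fl.
have [_ _ h] := colour_dir_cross (ltn_ord m) sl.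
rewrite !colour_dirE ?(ltnW (ltn_ord m)) // ?(ltnW fl) // h.
by case: c {sl h}; case: (one_resolved _ _).
Qed.

Lemma orientation_colouring_colour_bits : orientation_colouring E o = chi.
Proof.
apply/setP => x; rewrite inE; case Px: (x \in P) => /=; last first.
  apply/esym/negbTE/negP => xchi; case/compatibleP: cv => _ /subsetP /(_ x xchi).
  by rewrite Px.
have /andP [x0 xn] := points_level fitsE Px.
rewrite /orientation_colour colour_dirE ?(ltnW xn) -?in_points //.
by rewrite /colour_dir occupiesE; case: (odd _); case: (x \in chi).
Qed.

End Colouring.

Lemma colour_bits_orientation (o : seq bool) : size o = count (@is_cup 0) E ->
  colour_bits (orientation_colouring E o) = o.
Proof.
move=> so; rewrite -[RHS](map_nth_filter_iota slice0 true so) /colour_bits.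
apply/eq_in_map => l; rewrite mem_filter mem_iota add0n => /andP [cl /andP [_ ln]].
rewrite /cup_pos; case sl: (nth slice0 E l) cl => [p|p|p c|[]//] // _.
have [d1 _ _] := dir_cup fitsE o ln sl; have [fl wl] := widthS fitsE ln.
rewrite sl /= in fl wl.
have pl : (p < width l.+1)%N by rewrite wl; lia.
rewrite -head_bits -d1 /colour_dir.
have [x Px [<- <-]] := point_at fitsE ln pl.
rewrite occupiesE in_orientation_colouring // /orientation_colour.
by case: (odd _); case: (dir _ _ _ _).
Qed.

End OrientationOfColouring.

(** * Lee generators as a basis of the homology of one plane diagram *)

Section LeeBasis.
Variable E : seq (slice 0).
Hypothesis fitsE : fits_from 0 E.
Variables (I : finType) (ob : I -> seq bool) (oref : seq bool).
Hypothesis ob_inj : injective ob.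
Hypothesis ob_size : forall i, size (ob i) = count (@is_cup 0) E.
Hypothesis ob_coh : forall i, coherent E (ob i).
Hypothesis ob_surj : forall o, size o = count (@is_cup 0) E -> coherent E o ->
  exists i, ob i = o.

Notation transform := (transform fitsE).
Notation res i := (oriented_resolution E (ob i)).
Notation col i := (orientation_colouring E (ob i)).
Notation compatible := (compatible fitsE).
Notation gen_deg i := (#|res i|%:Z - (n_minus E oref)%:Z).

Lemma transform_sum (Q : pred I) (b : I -> rat) (f : I -> chain E) v chi :
  transform (\sum_(i | Q i) b i *: f i) v chi = \sum_(i | Q i) b i * transform (f i) v chi.
Proof.
elim/big_rec2: _ => [|i y1 y2 _ <-]; first exact: transform0.
exact: transformD.
Qed.

Lemma compatible_res i : compatible (res i) (col i).
Proof. exact: compatible_orientation. Qed.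

Lemma transform_lee_gen_diag i : transform (lee_gen E (ob i)) (res i) (col i) != 0.
Proof. by rewrite transform_lee_gen ?eqxx // compatible_res. Qed.

(** With [transform_lee_gen_diag]: the functionals at the pairs ([res k], [col k]) are dual to the
    Lee generators up to nonzero scalars. *)
Lemma transform_lee_gen_off i k : i != k -> transform (lee_gen E (ob i)) (res k) (col k) = 0.
Proof.
move=> ik; apply/eqP; apply: contraNT ik.
rewrite transform_lee_gen ?compatible_res // => /andP [_ /eqP ck].
apply/eqP/ob_inj; rewrite -(colour_bits_orientation fitsE (ob_size i)).
by rewrite -(colour_bits_orientation fitsE (ob_size k)) ck.
Qed.

(** An edge acting on the generator would need a monochromatic crossing, and the colouring of an
    orientation has none. *)
Lemma lee_gen_cycle i : lee_gen E (ob i) \in cycles E oref (gen_deg i).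
Proof.
rewrite memv_cap memv_ker; apply/andP; split.
  apply/graded_pieceP => g; rewrite ffunE /hdeg.
  by case: (gvertex g =P res i) => [-> //|_]; rewrite eqxx.
apply/eqP/(transform_eq0 (fitsE := fitsE)) => w chi; rewrite transform_diff.
case: ifP => // cw; rewrite big1 // => m wm.
have [-> | nz] := eqVneq (transform (lee_gen E (ob i)) (w :\ m) chi) 0; first by rewrite mulr0.
have [cm _] := transform_neq0 nz; move: nz; rewrite transform_lee_gen // => /andP [_ /eqP chiE].
have Km : m \in crossings E by case/compatibleP: cw => /subsetP Kw _ _; apply: Kw.
have := orientation_not_mono fitsE (ob i) Km.
by rewrite -chiE -(compatibleD1 wm cw) cm.
Qed.

Lemma transform_wrong_degree j c i : c \in cycles E oref j -> gen_deg i != j ->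
  transform c (res i) (col i) = 0.
Proof.
rewrite memv_cap => /andP [/graded_pieceP cj _] ij; apply/eqP; apply: contraNT ij.
by case/transform_neq0=> _ [g gi /cj <-]; rewrite /hdeg gi.
Qed.

(** Coefficients come from the dual functionals. The difference then vanishes at every labelling
    without monochromatic crossing, since such a labelling comes from an orientation, and
    [cycle_boundary] applies. *)
Lemma lee_gen_span j c : c \in cycles E oref j -> exists b : I -> rat,
  c - \sum_(i | gen_deg i == j) b i *: lee_gen E (ob i) \in boundaries E oref j.
Proof.
move=> cj; pose a i := transform (lee_gen E (ob i)) (res i) (col i).
exists (fun i => transform c (res i) (col i) / a i).
apply: (cycle_boundary (fitsE := fitsE)).
  apply: rpredB => //; apply: rpred_sum => i /eqP <-.
  by apply: rpredZ; apply: lee_gen_cycle.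
move=> v chi cv nm.
have [i oi] := ob_surj (size_colour_bits chi) (coherent_colour_bits cv nm).
have vE : res i = v by rewrite oi (oriented_resolution_colour_bits cv nm).
have chiE : col i = chi by rewrite oi (orientation_colouring_colour_bits cv nm).
rewrite -vE -chiE addrC -scaleN1r transformD mulN1r transform_sum.
apply/eqP; rewrite addrC subr_eq0; apply/eqP.
have [ij|ij] := eqVneq (gen_deg i) j.
  rewrite (bigD1 i) ?ij //= big1 ?addr0 ?divfK ?transform_lee_gen_diag // => k /andP [_ ki].
  by rewrite transform_lee_gen_off ?mulr0.
rewrite (transform_wrong_degree cj ij) big1 // => k /eqP kj.
rewrite transform_lee_gen_off ?mulr0 //.
by apply: contraNneq ij => <-; apply/eqP.
Qed.

(** The dual functionals vanish on boundaries. *)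
Lemma lee_gen_free j (b : I -> rat) :
  \sum_(i | gen_deg i == j) b i *: lee_gen E (ob i) \in boundaries E oref j ->
  forall i, gen_deg i == j -> b i = 0.
Proof.
move=> bB i ij; have := boundary_transform fitsE (res i) (chi := col i) bB.
move/(_ (orientation_not_mono fitsE (ob i))).
rewrite transform_sum (bigD1 i) //= big1 ?addr0.
  by move/eqP; rewrite mulf_eq0 (negbTE (transform_lee_gen_diag i)) orbF => /eqP.
by move=> k /andP [_ ki]; rewrite transform_lee_gen_off ?mulr0.
Qed.

End LeeBasis.

(** * Full twists and degrees *)

Section Runs.
Variables (r : nat) (V : nmodType) (F : slice r -> seq bool -> V).
Implicit Types (D : seq (slice r)) (st o : seq bool).

(** Sums of a quantity depending on a slice and the directions below it, such as [n_minus]. This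
    form is additive under concatenation, as needed to replace an arc by a braid. *)
Fixpoint run_sum D st o : V :=
  if D is s :: D' then F s st + run_sum D' (dir_step s st o) (bits_step s o) else 0.

Fixpoint run_end D st o : seq bool * seq bool :=
  if D is s :: D' then run_end D' (dir_step s st o) (bits_step s o) else (st, o).

Lemma run_sum_cons s D st o :
  run_sum (s :: D) st o = F s st + run_sum D (dir_step s st o) (bits_step s o).
Proof. by []. Qed.

Lemma run_end_cons s D st o :
  run_end (s :: D) st o = run_end D (dir_step s st o) (bits_step s o).
Proof. by []. Qed.

Lemma run_sum_cat D1 D2 st o : run_sum (D1 ++ D2) st o =
  run_sum D1 st o + run_sum D2 (run_end D1 st o).1 (run_end D1 st o).2.
Proof.
by elim: D1 st o => [|s D1 IH] st o /=; rewrite ?add0r // IH addrA.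
Qed.

Lemma run_end_cat D1 D2 st o :
  run_end (D1 ++ D2) st o = run_end D2 (run_end D1 st o).1 (run_end D1 st o).2.
Proof. by elim: D1 st o => [|s D1 IH] st o /=. Qed.

Lemma run_sumE D st o :
  \sum_(l < size D) F (tnth (in_tuple D) l) (nth [::] (dirs_from D st o) l) = run_sum D st o.
Proof.
elim: D st o => [|s D IH] st o; first by rewrite big_ord0.
rewrite big_ord_recl dirs_from_cons /= -IH; congr (_ + _).
by apply: eq_bigr => l _; rewrite !(tnth_nth s).
Qed.

End Runs.

Definition negative_slice r (s : slice r) (st : seq bool) : nat :=
  if s is Cross p b then b != (nth true st p == nth true st p.+1) else false.

Definition incoherent_slice r (s : slice r) (st : seq bool) : nat :=
  if s is Cap p then nth true st p == nth true st p.+1 else false.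

Lemma n_minusE (E : seq (slice 0)) o : n_minus E o = run_sum (@negative_slice 0) E [::] o.
Proof.
rewrite -run_sumE /n_minus -sum1dep_card big_mkcond; apply: eq_bigr => l _.
rewrite /is_negative /negative_slice /slice_at /dir.
by case: (tnth _ _) => [p|p|p b|i p m] //; case: ifP.
Qed.

Lemma coherentE r (D : seq (slice r)) o :
  coherent D o = (run_sum (@incoherent_slice r) D [::] o == 0%N).
Proof.
rewrite -run_sumE sum_nat_eq0; apply: eq_forallb => l.
rewrite /incoherent_slice /dir; case: (tnth _ _) => [p|p|p b|i p m] //=.
by rewrite eqb0.
Qed.

Section FullTwist.

Definition twist_row (b : bool) (p n : nat) : seq (slice 0) :=
  [seq Cross 0 (p + j) b | j <- iota 0 n.-1].

Lemma twist_rowS b p n : twist_row b p n.+2 = Cross 0 p b :: twist_row b p.+1 n.+1.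
Proof.
rewrite /twist_row /= addn0; congr (_ :: _).
rewrite -[1%N]/(1 + 0)%N iotaDl -map_comp; apply: eq_map => j /=.
by rewrite addnA addn1.
Qed.

Lemma dir_step_cross r (a c : seq bool) x y b o :
  dir_step (Cross r (size a) b) (a ++ x :: y :: c) o = a ++ y :: x :: c.
Proof.
rewrite /dir_step take_size_cat // !nth_cat ltnn subnn ltnNge leqnSn /= subSnn /=.
by rewrite -add2n -drop_drop drop_size_cat //= drop0.
Qed.

(** The leftmost strand passes over to the right end; a right-handed crossing is negative exactly
    when its strands are antiparallel. *)
Lemma run_twist_row (x : bool) (t a c o : seq bool) :
  run_end (twist_row true (size a) (size t).+1) (a ++ x :: t ++ c) o = (a ++ t ++ x :: c, o) /\
  run_sum (@negative_slice 0) (twist_row true (size a) (size t).+1) (a ++ x :: t ++ c) o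
    = count (predC1 x) t.
Proof.
elim: t a => [|y t IH] a; first by [].
rewrite [size (y :: t)]/= twist_rowS; have := IH (rcons a y).
rewrite size_rcons -!cats1 -!catA => -[h1 h2].
rewrite run_end_cons run_sum_cons dir_step_cross /bits_step h1 h2; split=> //=.
rewrite !nth_cat ltnn subnn ltnNge leqnSn /= subSnn /= [y == x]eq_sym.
by case: (x == y).
Qed.

(* Each row moves one strand past all the others, so a full twist has one
   negative crossing for every ordered pair of antiparallel strands. *)
Lemma run_twist_rows (t2 t1 a c o : seq bool) :
  let rows := flatten (nseq (size t2) (twist_row true (size a) (size t1 + size t2))) in
  run_end rows (a ++ t2 ++ t1 ++ c) o = (a ++ t1 ++ t2 ++ c, o) /\
  run_sum (@negative_slice 0) rows (a ++ t2 ++ t1 ++ c) o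
    = (\sum_(x <- t2) count (predC1 x) (t2 ++ t1))%N.
Proof.
elim: t2 t1 => [|x t2 IH] t1; first by rewrite big_nil.
rewrite /= run_end_cat run_sum_cat.
have [] := @run_twist_row x (t2 ++ t1) a c o; rewrite size_cat addnC -addnS -catA => -> -> /=.
have := IH (rcons t1 x); rewrite size_rcons addSnnS -cats1 -!catA /= => -[-> ->].
split=> //; rewrite big_cons /= eqxx add0n; congr (_ + _)%N.
apply: eq_bigr => y _; rewrite !count_cat /=.
rewrite addn0; lia.
Qed.

Lemma sum_count_bool (t : seq bool) :
  (\sum_(x <- t) count (predC1 x) t = 2 * (count id t * count negb t))%N.
Proof.
have H (f : bool -> nat) s : (\sum_(x <- s) f x = count id s * f true + count negb s * f false)%N.
  by elim: s => [|[] s IH]; rewrite ?big_nil // big_cons IH /=; lia.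
rewrite H; have -> : count (predC1 true) t = count negb t by apply: eq_count => -[].
have -> : count (predC1 false) t = count id t by apply: eq_count => -[].
lia.
Qed.

Lemma run_full_twists (k : nat) (t a c o : seq bool) :
  let twists := full_twists k (size a) (size t) in
  run_end twists (a ++ t ++ c) o = (a ++ t ++ c, o) /\
  run_sum (@negative_slice 0) twists (a ++ t ++ c) o
    = (k * (2 * (count id t * count negb t)))%N.
Proof.
rewrite /full_twists; elim: k => [|k [IH1 IH2]] //=.
have [] := @run_twist_rows t [::] a c o; rewrite /= add0n cats0 sum_count_bool => h1 h2.
by rewrite mulSn nseqD flatten_cat run_end_cat run_sum_cat h1 h2 /= IH1 IH2; split=> //; lia.
Qed.

End FullTwist.

(** * Comparison of D with its finite approximations *)

Section Approximation.
Variables (r k : nat).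
Implicit Types (s : slice r) (D : seq (slice r)) (st o : seq bool).

Definition approx_slice s : seq (slice 0) :=
  match s with
  | Cup p => [:: Cup 0 p]
  | Cap p => [:: Cap 0 p]
  | Cross p b => [:: Cross 0 p b]
  | Arc i p n => full_twists k p n
  end.

Lemma approx_cons s D : approx (s :: D) (fun=> k%:Z) = approx_slice s ++ approx D (fun=> k%:Z).
Proof. by []. Qed.

Lemma full_twists_all (a : pred (slice 0)) p n :
  (forall j, (j < n.-1)%N -> a (Cross 0 (p + j) true)) -> all a (full_twists k p n).
Proof.
move=> h; have row : all a (twist_row true p n).
  rewrite all_map (eq_in_all (a2 := xpredT)) ?all_predT // => j.
  by rewrite mem_iota => /andP [_ jn]; apply: h.
rewrite /full_twists; elim: (`|_| * n)%N => //= m IH.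
by rewrite all_cat IH andbT.
Qed.

Lemma fits_from_cat_level w (F E : seq (slice 0)) :
  all (fun e => fits w e && (next_width w e == w)) F -> fits_from w (F ++ E) = fits_from w E.
Proof. by elim: F => //= e F IH /andP [/andP [-> /eqP ->] /IH]. Qed.

Lemma approx_fits w D : fits_from w D -> fits_from w (approx D (fun=> k%:Z)).
Proof.
elim: D w => [|s D IH] w //= /andP [fs /IH fD].
case: s fs fD => [p|p|p b|i p n] /= fs fD; rewrite ?approx_cons /= ?fs //.
rewrite fits_from_cat_level //; apply: full_twists_all => j jn /=.
by rewrite eqxx andbT; lia.
Qed.

Lemma approx_cups D : count (@is_cup 0) (approx D (fun=> k%:Z)) = count (@is_cup r) D.
Proof.
elim: D => [|s D IH] //; rewrite approx_cons count_cat IH; congr addn.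
case: s => [p|p|p b|i p n] //=; apply/eqP; rewrite -leqn0 leqNgt -has_count.
by rewrite -all_predC; apply: full_twists_all.
Qed.

Lemma split_segment (st : seq bool) p n :
  st = take p st ++ take n (drop p st) ++ drop n (drop p st).
Proof. by rewrite !cat_take_drop. Qed.

Lemma run_end_approx_slice s st o : fits (size st) s ->
  run_end (approx_slice s) st o = (dir_step s st o, bits_step s o).
Proof.
case: s => [p|p|p b|i p n] //= fs; rewrite /bits_step /=.
rewrite (split_segment st p n).
have sp : size (take p st) = p by rewrite size_takel; lia.
have sn : size (take n (drop p st)) = n by rewrite size_takel // size_drop; lia.
have [+ _] := run_full_twists k (take n (drop p st)) (take p st) (drop n (drop p st)) o.
by rewrite sp sn.
Qed.

(** A full twist returns the directions it receives, so D and D(k) can be compared slice by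
    slice. *)
Lemma run_sum_approx (F0 : slice 0 -> seq bool -> nat) (F1 : slice r -> seq bool -> nat) D st o :
  (forall s st o, fits (size st) s -> run_sum F0 (approx_slice s) st o = F1 s st) ->
  fits_from (size st) D ->
  run_sum F0 (approx D (fun=> k%:Z)) st o = run_sum F1 D st o.
Proof.
move=> FE; elim: D st o => [|s D IH] st o //= /andP [fs fD].
rewrite approx_cons run_sum_cat FE // run_end_approx_slice // IH //.
by rewrite size_dir_step.
Qed.

Lemma approx_coherent D o : fits_from 0 D -> coherent (approx D (fun=> k%:Z)) o = coherent D o.
Proof.
move=> fD; rewrite !coherentE; congr (_ == _); apply: run_sum_approx => //.
move=> s st o' fs; case: s fs => [p|p|p b|i p n] //= fs; rewrite ?addr0 //.
have : all (fun s : slice 0 => if s is Cap _ then false else true) (full_twists k p n).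
  exact: full_twists_all.
by elim: (full_twists k p n) st o' {fs} => [|[q|q|q b|j q m] E IH] st o' //= /IH ->.
Qed.

Definition segment p n st := take n (drop p st).

Definition approx_negative s st : nat :=
  if s is Arc _ p n then
    (k * (2 * (count id (segment p n st) * count negb (segment p n st))))%N
  else negative_slice s st.

Lemma approx_n_minus D o : fits_from 0 D ->
  n_minus (approx D (fun=> k%:Z)) o = run_sum approx_negative D [::] o.
Proof.
move=> fD; rewrite n_minusE; apply: run_sum_approx => //.
move=> s st o' fs; case: s fs => [p|p|p b|i p n] //= fs; rewrite ?addr0 //.
rewrite [in LHS](split_segment st p n).
have sp : size (take p st) = p by rewrite size_takel; lia.
have sn : size (take n (drop p st)) = n by rewrite size_takel // size_drop; lia.
have [_ +] := run_full_twists k (take n (drop p st)) (take p st) (drop n (drop p st)) o'.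
by rewrite sp sn.
Qed.

End Approximation.

(** * Degrees of the Lee generators as functions of k *)

Section Degrees.
Variables (r : nat) (D : diagram r).
Implicit Types (o : orientation D) (i : 'I_r).

Notation lev o l := (nth [::] (dirs_from D [::] o) l).
Notation sl l := (tnth (in_tuple D) l).

Lemma diagram_fits : fits_from 0 D.
Proof. by case: D => s /= /andP []. Qed.

Lemma arc_level i : exists l : 'I_(size D), forall l', is_arc i (sl l') = (l' == l).
Proof.
have : count (is_arc i) D == 1%N by case: D => s /= /andP [_ /forallP].
rewrite -sum1_count big_tnth sum1dep_card => /cards1P [l lE]; exists l => l'.
by have := in_set1 l' l; rewrite -lE inE.
Qed.

Lemma level_fits (E : seq (slice r)) st (o : seq bool) (l : 'I_(size E)) : fits_from (size st) E ->
  fits (size (nth [::] (dirs_from E st o) l)) (tnth (in_tuple E) l).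
Proof.
elim: E st o l => [|s E IH] st o l; first by case: l.
move=> /andP [fs fE]; rewrite dirs_from_cons (tnth_nth s) /=.
case: l => -[|l] /= lE //; rewrite ltnS in lE.
have := IH (dir_step s st o) (bits_step s o) (Ordinal lE).
by rewrite (tnth_nth s) /= size_dir_step //; apply.
Qed.

Lemma sum_signs (st : seq bool) p n : (p + n <= size st)%N ->
  \sum_(p <= q < p + n) (if nth true st q then 1 else -1)
  = (count id (segment p n st))%:Z - (count negb (segment p n st))%:Z :> int.
Proof.
move=> pn; set t := segment p n st.
have st' : size t = n by rewrite size_takel // size_drop; lia.
transitivity (\sum_(x <- t) (if x then 1 else -1) : int).
  rewrite -{1}[p]add0n big_addn addKn (big_nth true) st'; apply: eq_big_nat => q /andP [_ qn].
  by rewrite nth_take // nth_drop addnC.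
elim: (t) => [|[] t' IH]; first by rewrite big_nil.
  by rewrite big_cons IH /=; lia.
by rewrite big_cons IH /=; lia.
Qed.

Definition arc_segment o (l : 'I_(size D)) : seq bool :=
  if sl l is Arc _ p n then segment p n (lev o l) else [::].

Lemma size_arc_segment o o' l : size (arc_segment o l) = size (arc_segment o' l).
Proof.
have F oo : fits (size (lev oo l)) (sl l) by apply: level_fits; apply: diagram_fits.
have := F o; have := F o'; rewrite /arc_segment; case: (sl l) => //= i p n f1 f2.
by rewrite !size_takel // size_drop; lia.
Qed.

Lemma eta_segment o i l : (forall l', is_arc i (sl l') = (l' == l)) ->
  eta D o i = (count id (arc_segment o l))%:Z - (count negb (arc_segment o l))%:Z.
Proof.
move=> lE; rewrite /eta (bigD1 l) //= big1 ?addr0.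
  have := lE l; have : fits (size (lev o l)) (sl l) by apply: level_fits; apply: diagram_fits.
  rewrite /arc_segment; case: (sl l) => [p|p|p b|j p n] //=; rewrite ?eqxx // => fl ->.
  exact: sum_signs.
move=> l' ll'; have := lE l'; rewrite (negbTE ll').
by case: (sl l') => [p|p|p b|j p n] //= ->.
Qed.

Lemma n_minus_approx_diag k o (l : 'I_r -> 'I_(size D)) :
  (forall i l', is_arc i (sl l') = (l' == l i)) ->
  n_minus (approx_diag D k) o = (run_sum (@negative_slice r) D [::] o +
    \sum_(i < r) k * (2 * (count id (arc_segment o (l i)) * count negb (arc_segment o (l i)))))%N.
Proof.
move=> lE; rewrite approx_n_minus ?diagram_fits // -!run_sumE.
pose G l' := (k * (2 * (count id (arc_segment o l') * count negb (arc_segment o l'))))%N.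
transitivity (\sum_l' (negative_slice (sl l') (lev o l') + \sum_i (is_arc i (sl l')) * G l'))%N.
  apply: eq_bigr => l' _; rewrite /approx_negative /G /arc_segment.
  case: (sl l') => [p|p|p b|j p n] /=.
  - by rewrite big1 // => i _; rewrite mul0n.
  - by rewrite big1 // => i _; rewrite mul0n.
  - by rewrite big1 ?addn0 // => i _; rewrite mul0n.
  rewrite (bigD1 j) //= eqxx mul1n big1 ?addn0 // => i ij.
  by rewrite eq_sym (negbTE ij).
rewrite big_split /=; congr addn; rewrite exchange_big; apply: eq_bigr => i _.
rewrite (bigD1 (l i)) //= lE eqxx mul1n big1 ?addn0 // => l' ll'.
by rewrite lE (negbTE ll').
Qed.

(* k full twists on u upward and d downward strands have 2kud negative crossings
   and 2ud = ((u + d)^2 - (u - d)^2) / 2, where u - d = eta and u + d does not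
   depend on the orientation. *)
Lemma lee_gen_degreeE (oL : orientation D) : two_divisible (homology_class oL) ->
  exists (base : orientation D -> int) (e : orientation D -> 'I_r -> int),
    (forall o i, eta D o i = 2 * e o i) /\
    forall k o, lee_gen_degree oL k o = base o - k%:Z * \sum_i 2 * e o i ^+ 2.
Proof.
case=> c cE; have [l lE] := fin_all_exists arc_level.
pose u o i : int := (count id (arc_segment o (l i)))%:Z.
pose d o i : int := (count negb (arc_segment o (l i)))%:Z.
have udE o i : u o i + d o i = u oL i + d oL i.
  rewrite /u /d -!PoszD; congr Posz.
  have szE t : (count id t + count negb t)%N = size t by apply: count_predC.
  by rewrite !szE; apply: size_arc_segment.
have etaE o i : eta D o i = u o i - d o i by apply: eta_segment.
have etaL i : eta D oL i = 2 * c 0 i.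
  have := congr1 (fun M : 'rV[int]_r => M 0 i) cE; rewrite !mxE => ->.
  by rewrite mulr2n; ring.
(* For [oL] one has u - d = 2c, so [c 0 i + d oL i] is half the number of strands crossing the i-th
   arc, and [e] is half of eta without a division. *)
pose e o i : int := u o i - (c 0 i + d oL i).
have eE o i : eta D o i = 2 * e o i.
  by have := udE o i; have := etaE oL i; rewrite etaL (etaE o) /e; lia.
pose base o : int := (run_sum (@negative_slice r) D [::] o)%:Z.
exists (fun o => base o - base oL), e; split=> // k o.
rewrite /lee_gen_degree /lee_gen_hdeg.
(* The crossings 1-resolved by the oriented resolution are the negative ones. *)
rewrite -[#|oriented_resolution _ _|]/(n_minus _ _) !(n_minus_approx_diag _ _ lE) /lee_shift.
have -> : \sum_i ((k%:Z * eta D oL i ^+ 2) %/ 2)%Z = \sum_i k%:Z * (2 * e oL i ^+ 2).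
  apply: eq_bigr => i _; rewrite eE.
  have -> : k%:Z * (2 * e oL i) ^+ 2 = k%:Z * (2 * e oL i ^+ 2) * 2 by ring.
  by rewrite mulzK.
rewrite !PoszD.
have sumE oo : (\sum_(i < r) k * (2 * (count id (arc_segment oo (l i)) *
      count negb (arc_segment oo (l i)))))%N%:Z = \sum_i k%:Z * (2 * (u oo i * d oo i)).
  by rewrite (big_morph Posz PoszD erefl).
rewrite !sumE mulr_sumr.
(* The terms in the number of strands cancel between o and oL, and the shift removes the eta term of
   oL. *)
have key : \sum_i k%:Z * (2 * (u o i * d o i)) - \sum_i k%:Z * (2 * (u oL i * d oL i))
   - \sum_i k%:Z * (2 * e oL i ^+ 2) = - \sum_i k%:Z * (2 * e o i ^+ 2).
  rewrite -!sumrB -sumrN; apply: eq_bigr => i _.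
  have h1 := udE o i; have h2 := eE o i; have h3 := eE oL i.
  have h4 : d o i = u oL i + d oL i - u o i by rewrite -h1; ring.
  have h5 : u oL i = d oL i + 2 * c 0 i by move: h3; rewrite -etaL etaE; lia.
  by rewrite /e h4 h5; ring.
by move: key; rewrite /base; lia.
Qed.

End Degrees.

(** * The stable limit *)

Lemma cycle_class_linear (E : seq (slice 0)) o j : linear (@cycle_class E o j).
Proof. by move=> a c1 c2; rewrite /cycle_class !linearP. Qed.

Section Assembly.
Variables (r : nat) (D : diagram r) (oL : orientation D).
Implicit Types (o : orientation D) (h : int) (k : nat).

Notation E k := (approx_diag D k).
Notation cls k h o := (cycle_class oL (h + lee_shift oL k) (lee_gen (E k) o)).
Notation deg k o := (lee_gen_degree oL k o).

Lemma approx_diag_fits k : fits_from 0 (E k).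
Proof. exact/approx_fits/diagram_fits. Qed.

Notation bits := (fun o : orientation D => o : seq bool).

Lemma orientation_inj : injective bits.
Proof. by move=> o o' /val_inj /val_inj. Qed.

Lemma orientation_size k o : size o = count (@is_cup 0) (E k).
Proof. by rewrite size_tuple approx_cups. Qed.

Lemma orientation_coherent k o : coherent (E k) o.
Proof. by rewrite approx_coherent ?diagram_fits //; apply: (valP o). Qed.

Lemma orientation_surj k (s : seq bool) : size s = count (@is_cup 0) (E k) -> coherent (E k) s ->
  exists o : orientation D, o = s :> seq bool.
Proof.
rewrite approx_cups approx_coherent ?diagram_fits // => /eqP ss cs.
by exists (@Orientation _ D (Tuple ss) cs).
Qed.

Lemma degE k h o :
  (#|oriented_resolution (E k) o|%:Z - (n_minus (E k) oL)%:Z == h + lee_shift oL k)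
  = (deg k o == h).
Proof. by rewrite /lee_gen_degree /lee_gen_hdeg [RHS]subr_eq. Qed.

Lemma lee_gen_is_cycleP k o : lee_gen_is_cycle oL k o.
Proof. exact: (@lee_gen_cycle _ (approx_diag_fits k) _ bits oL (orientation_coherent k) o). Qed.

Lemma boundaries_in_cycles k j : (boundaries (E k) oL j <= cycles (E k) oL j)%VS.
Proof. exact: boundaries_cycles (approx_diag_fits k) oL j. Qed.

Lemma cls_sum k h (Q : pred (orientation D)) (b : orientation D -> rat) :
  cycle_class oL (h + lee_shift oL k) (\sum_(o | Q o) b o *: lee_gen (E k) o)
  = \sum_(o | Q o) b o *: cls k h o.
Proof.
pose f := HB.pack_for {linear chain (E k) -> homology (E k) oL (h + lee_shift oL k)}
  (@cycle_class (E k) oL (h + lee_shift oL k))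
  (GRing.isLinear.Build _ _ _ _ _ (@cycle_class_linear (E k) oL (h + lee_shift oL k))).
by rewrite -[cycle_class _ _]/(f : _ -> _) linear_sum; apply: eq_bigr => o _; rewrite linearZ.
Qed.

Lemma cls_span k h (u : approx_homology oL k h) :
  exists b : orientation D -> rat, u = \sum_(o | deg k o == h) b o *: cls k h o.
Proof.
have [c cZ <-] := cycle_class_surj u.
have [b bB] := @lee_gen_span _ (approx_diag_fits k) _ bits oL orientation_inj (orientation_size k)
  (orientation_coherent k) (@orientation_surj k) _ _ cZ.
exists b; rewrite -cls_sum; under [in RHS]eq_bigl => o do rewrite -degE.
set d := \sum_(o | _) _ in bB *.
have dc : c - d \in cycles (E k) oL (h + lee_shift oL k).
  exact: subvP (boundaries_in_cycles k _) _ bB.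
have := cycle_class_eq0 (boundaries_in_cycles k _) dc; rewrite bB.
have -> : c - d = -1 *: d + c by rewrite scaleN1r [RHS]addrC.
by rewrite cycle_class_linear scaleN1r addr_eq0 eqr_opp eq_sym => /eqP.
Qed.

Lemma cls_free k h (b : orientation D -> rat) : \sum_(o | deg k o == h) b o *: cls k h o = 0 ->
  forall o, deg k o == h -> b o = 0.
Proof.
rewrite -cls_sum => s0 o; rewrite -degE => oh.
apply: (@lee_gen_free _ (approx_diag_fits k) _ bits oL orientation_inj (orientation_size k)
  (orientation_coherent k) _ b _ o oh).
under eq_bigl => o' do rewrite degE.
rewrite -cycle_class_eq0 ?s0 //; first exact: boundaries_in_cycles.
apply: rpred_sum => o' /eqP <-; apply: rpredZ.
rewrite /lee_gen_degree subrK; exact: lee_gen_is_cycleP.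
Qed.

Variables (base N : orientation D -> int).
Hypothesis degreeE : forall k o, deg k o = base o - k%:Z * N o.
Hypothesis N_null : forall o, o \in null_orientations D -> N o = 0.
Hypothesis N_not_null : forall o, o \notin null_orientations D -> 1 <= N o.

(** Beyond it k exceeds the distance of h from every [base o], so [base o - k N o] cannot equal h
    once N o is at least 1. *)
Definition degree_bound h : nat := (\sum_(o : orientation D) `|base o - h|.+1)%N.

Lemma degree_null k o : o \in null_orientations D -> deg k o = base o.
Proof. by move=> /N_null No; rewrite degreeE No mulr0 subr0. Qed.

Lemma degree_large h k o : (degree_bound h <= k)%N ->
  (deg k o == h) = (o \in null_orientations D) && (base o == h).
Proof.
move=> hk; have [on | on] := boolP (o \in _); first by rewrite degree_null.
have := N_not_null on; rewrite degreeE => N1; apply/negbTE/eqP => dE.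
have : (`|base o - h| < k)%N.
  apply: leq_trans hk; rewrite /degree_bound (bigD1 o) //=; exact: leq_addr.
have kN : base o - h = k%:Z * N o by rewrite -dE; ring.
rewrite kN abszM /=; move: N1; nia.
Qed.

Lemma extend_coef (A : {set orientation D}) (c : 'I_#|A| -> rat) :
  exists b : orientation D -> rat,
    (forall i, b (enum_val i) = c i) /\ (forall o, o \notin A -> b o = 0).
Proof.
exists (fun o => \sum_(i | enum_val i == o) c i); split=> [i | o oA].
  by rewrite (big_pred1 i) // => i'; apply: (inj_eq enum_val_inj).
by rewrite big_pred0 // => i; apply: contraNF oA => /eqP <-; apply: enum_valP.
Qed.

(** For all large k the same set [S h] of null-homologous orientations indexes a basis of the
    homology in degree h; coordinates in it identify these spaces with one model. *)
Lemma lee_limit_exists : inhabited (lee_limit oL).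
Proof.
pose S h := [set o in null_orientations D | base o == h].
pose X k h : #|S h|.-tuple (approx_homology oL k h) := [tuple cls k h (enum_val i) | i < #|S h|].
pose f k h (u : approx_homology oL k h) : 'rV[rat]_#|S h| := \row_i coord (X k h) i u.
have f_lin k h : linear (f k h).
  by move=> a u w; apply/rowP => i; rewrite !mxE linearP.
pose fL k h := HB.pack_for {linear approx_homology oL k h -> 'rV[rat]_#|S h|} (f k h)
  (GRing.isLinear.Build _ _ _ _ _ (f_lin k h)).
have fE k h u : linfun (fL k h) u = f k h u by rewrite lfunE.
constructor; apply: (@LeeLimit _ _ oL (fun h => 'rV[rat]_#|S h|) degree_bound
  (fun h k => linfun (fL k h))) => h k hk.
have SE o : (deg k o == h) = (o \in S h) by rewrite (degree_large _ hk) /S !in_set.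
have nthX (i : 'I_#|S h|) : (X k h)`_i = cls k h (enum_val i) by rewrite -tnth_nth tnth_mktuple.
have freeX : free (X k h).
  apply/freeP => c c0 i; have [b [bE b0]] := extend_coef c.
  rewrite -bE; apply: (@cls_free k h b); last by rewrite SE enum_valP.
  rewrite -[RHS]c0 (eq_bigl _ _ SE) big_enum_val; apply: eq_bigr => i' _.
  by rewrite nthX bE.
have spanX u : u \in <<X k h>>%VS.
  have [b ->] := cls_span u; rewrite (eq_bigl _ _ SE) big_enum_val.
  apply: memv_suml => i _; apply: memvZ; rewrite -nthX; apply: memv_span.
  by apply: mem_nth; rewrite size_tuple.
split.
  apply/eqP; rewrite -subv0; apply/subvP => u; rewrite memv_ker memv0 => /eqP fu.
  rewrite (coord_span (spanX u)) big1 // => i _.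
  by move/rowP: fu => /(_ i); rewrite fE !mxE => ->; rewrite scale0r.
apply/vspaceP => w; rewrite memvf.
have -> : w = linfun (fL k h) (\sum_i w 0 i *: (X k h)`_i).
  by rewrite fE; apply/rowP => i; rewrite mxE coord_sum_free.
by apply: memv_img; apply: memvf.
Qed.

Lemma lee_limit_trivial (V : lee_limit oL) h (v : V h) :
  (forall o, o \in null_orientations D -> base o != h) -> v = 0.
Proof.
move=> nh; pose k := maxn (stable_from V h) (degree_bound h).
have [_ img] := lee_identP (h := h) (leq_maxl (stable_from V h) (degree_bound h)).
have /memv_imgP [u _ ->] : v \in limg (lee_ident V h k) by rewrite img memvf.
have [b ->] := cls_span u; rewrite big_pred0 ?linear0 // => o.
rewrite degree_large ?leq_maxr //; apply/negP => /andP [on]; exact/negP/nh.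
Qed.

Lemma lee_generators_basis (V : lee_limit oL) :
  exists K : nat, forall k : nat, (K <= k)%N ->
    direct_sum_iso
      (fun (a : 'rV[rat]_#|null_orientations D|) (h : int) =>
         \sum_(i | lee_gen_degree oL k (enum_val i) == h)
            a 0 i *: lee_gen_class k (enum_val i) V h).
Proof.
(* The limit vanishes outside the degrees [base o], so k has to be large for finitely many degrees
   only; the sum dominates all these thresholds. *)
exists (\sum_o (stable_from V (base o) + degree_bound (base o)))%N => k Kk.
have stab o : (stable_from V (base o) <= k)%N /\ (degree_bound (base o) <= k)%N.
  by move: Kk; rewrite (bigD1 o) //=; lia.
have fE (a : 'rV[rat]_#|null_orientations D|) h b :
    (forall i, b (enum_val i) = a 0 i) ->
    (forall o, deg k o == h -> o \in null_orientations D) ->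
    \sum_(i | deg k (enum_val i) == h) a 0 i *: lee_gen_class k (enum_val i) V h
    = lee_ident V h k (\sum_(o | deg k o == h) b o *: cls k h o).
  move=> bE nullh; rewrite linear_sum.
  rewrite (eq_bigl (fun o => (o \in null_orientations D) && (deg k o == h))); last first.
    by move=> o; case: (boolP (_ == h)) => [/nullh -> | _]; rewrite ?andbF.
  rewrite big_enum_val_cond; apply: eq_bigr => i _.
  by rewrite linearZ bE.
have nullE o0 o : deg k o == base o0 -> o \in null_orientations D.
  by rewrite degree_large ?(stab o0).2 // => /andP [].
split.
- move=> h a x y; rewrite scaler_sumr -big_split /=; apply: eq_bigr => i _.
  by rewrite !mxE scalerDl scalerA.
- move=> a; exists [seq deg k (enum_val i) | i : 'I_#|null_orientations D|] => h hs.
  rewrite big_pred0 // => i; apply: contraNF hs => /eqP <-.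
  by apply/mapP; exists i => //; rewrite mem_enum.
- move=> x y xy; apply/rowP => i; set h := base (enum_val i).
  have [bx [bxE _]] := extend_coef (fun i => x 0 i).
  have [bY [byE _]] := extend_coef (fun i => y 0 i).
  have [ker _] := lee_identP (h := h) (stab (enum_val i)).1.
  have := xy h; rewrite (fE x h bx bxE) ?(fE y h bY byE); try exact: nullE.
  have /lker0P inj : lker (lee_ident V h k) == 0%VS by apply/eqP.
  move/inj => sE.
  rewrite -bxE -byE; apply/eqP; rewrite -subr_eq0; apply/eqP.
  apply: (@cls_free k h (fun o => bx o - bY o)).
    apply/eqP; under eq_bigr => o _ do rewrite scalerBl.
    by rewrite sumrB subr_eq0; apply/eqP.
  by rewrite degree_null ?enum_valP.
- move=> v vfin.
  have /fin_all_exists [B BE] (i : 'I_#|null_orientations D|) : exists b : orientation D -> rat,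
      v (base (enum_val i)) = lee_ident V _ k
        (\sum_(o | deg k o == base (enum_val i)) b o *: cls k (base (enum_val i)) o).
    have [_ img] := lee_identP (h := base (enum_val i)) (stab (enum_val i)).1.
    have /memv_imgP [u _ ->] : v (base (enum_val i)) \in limg (lee_ident V _ k).
      by rewrite img memvf.
    by have [b ->] := cls_span u; exists b.
  (* The degree is generalised, so that values in [V h] are compared without a cast. *)
  have {}BE i h : base (enum_val i) = h ->
      v h = lee_ident V h k (\sum_(o | deg k o == h) B i o *: cls k h o).
    by move=> <-; apply: BE.
  exists (\row_i B i (enum_val i)) => h.
  have [i0 /eqP hi0 | none] :=
    pickP (fun i : 'I_#|null_orientations D| => base (enum_val i) == h); last first.
    rewrite big_pred0; last by move=> i; rewrite degree_null ?enum_valP.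
    apply/esym/(@lee_limit_trivial V) => o on.
    by have := none (enum_rank_in on o); rewrite enum_rankK_in // => ->.
  have nullh o : deg k o == h -> o \in null_orientations D by rewrite -hi0; apply: nullE.
  have [b [bE _]] := extend_coef (fun i =>
    (\row_i B i (enum_val i) : 'rV_#|null_orientations D|) 0 i).
  rewrite (fE _ h b bE nullh) (BE i0 h hi0); congr (lee_ident V h k _).
  apply: eq_bigr => o oh; congr (_ *: _); have on := nullh o oh.
  pose i := enum_rank_in on o; have oE : enum_val i = o by rewrite enum_rankK_in.
  have hi : base (enum_val i) = h by rewrite oE -(degree_null k on); apply/eqP.
  rewrite -oE bE mxE; apply/eqP; rewrite -subr_eq0; apply/eqP.
  (* The coefficients [B i] and [B i0] were chosen separately in the same degree h; freeness makes
     them agree. *)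
  apply: (@cls_free k h (fun o => B i o - B i0 o)); last by rewrite oE.
  have sk : (stable_from V h <= k)%N by rewrite -hi0; case: (stab (enum_val i0)).
  have [ker _] := lee_identP sk.
  have /lker0P inj : lker (lee_ident V h k) == 0%VS by apply/eqP.
  apply/eqP; under eq_bigr => o' _ do rewrite scalerBl.
  by rewrite sumrB subr_eq0; apply/eqP/inj; rewrite -!BE.
Qed.

End Assembly.

Theorem theorem1p2 (r : nat) (D : diagram r) (oL : orientation D) :
  two_divisible (homology_class oL) ->
  inhabited (lee_limit oL) /\
  forall KhLee : lee_limit oL,
    exists K : nat, forall k : nat, (K <= k)%N ->
      (forall o : orientation D, o \in null_orientations D ->
         lee_gen_is_cycle oL k o) /\
      direct_sum_iso
        (fun (a : 'rV[rat]_#|null_orientations D|) (h : int) =>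
           \sum_(i | lee_gen_degree oL k (enum_val i) == h)
              a 0 i *: lee_gen_class k (enum_val i) KhLee h).
Proof.
move=> /lee_gen_degreeE [base [e [etaE degE]]].
(* Half the sum of the squares of eta: the rate at which the degree of o falls as k grows. Being an
   integer, it is at least 1 unless every eta vanishes. *)
pose N o : int := \sum_i 2 * e o i ^+ 2.
have N0 o : (N o == 0) = (o \in null_orientations D).
  rewrite psumr_eq0 => [|i _]; last by rewrite mulr_ge0 ?sqr_ge0.
  rewrite inE; apply/allP/eqP => [e0 | o0 i _].
    apply/rowP => i; rewrite !mxE etaE; apply/eqP.
    have /implyP/(_ isT) := e0 i (mem_index_enum i).
    by rewrite !mulf_eq0 /= orbb.
  have := congr1 (fun M : 'rV[int]_r => M 0 i) o0; rewrite !mxE etaE => /eqP.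
  by rewrite mulf_eq0 /= => /eqP ->.
have N_null o : o \in null_orientations D -> N o = 0 by rewrite -N0 => /eqP.
have N_not_null o : o \notin null_orientations D -> 1 <= N o.
  rewrite -N0 => Nn0; rewrite -[1]add0r lezD1 lt_neqAle eq_sym Nn0 /=.
  by apply: sumr_ge0 => i _; rewrite mulr_ge0 ?sqr_ge0.
split; first exact: lee_limit_exists degE N_null N_not_null.
move=> KhLee; have [K KP] := lee_generators_basis degE N_null N_not_null KhLee.
exists K => k Kk; split; last exact: KP.
by move=> o _; apply: lee_gen_is_cycleP.
Qed.
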